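(* \textsc{Diverse Minimum Cuts} admits a polynomial-time approximation scheme.
   Context: Let $G=(V,E)$ be a graph. A cut of $G$ is a partition of $V$ into two nonempty sets $A,B$; its edge set $E(A,B)$ consists of the edges with one end in $A$ and the other in $B$, and cuts are identified with these edge sets. The size of a cut is $|E(A,B)|$, and a minimum cut is a cut of minimum size (number of edges). For $w\colon E\to\mathbb R_{\ge 0}$ and $Z\subseteq E$, $w(Z)=\sum_{e\in Z}w(e)$, and $d_{\mathrm{sum}}(\{C_1,\dots,C_k\})=\sum_{1\le i<j\le k} w(C_i\triangle C_j)$. \textsc{Diverse Minimum Cuts}: given a graph $G=(V,E)$, an edge-weight function $w\colon E\to\mathbb R_{\ge 0}$ and an integer $k$, find $k$ distinct minimum cuts $C_1,\dots,C_k\subseteq E$ of $G$ maximizing $d_{\mathrm{sum}}(\{C_1,\dots,C_k\})$. A polynomial-time approximation scheme is an algorithm which, for every constant $\varepsilon>0$, outputs in polynomial time a feasible solution of value at least $(1-\varepsilon)$ times the optimum. *)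

(* Defs.v *)
From HB Require Import structures.
From mathcomp Require Import all_boot all_order all_algebra.
From mathcomp Require Import reals.

Set Implicit Arguments.
Unset Strict Implicit.
Unset Printing Implicit Defensive.

Import Order.TTheory GRing.Theory Num.Theory.
Local Open Scope ring_scope.

(** * Model of computation

   Jones's WHILE language (N. D. Jones, "Computability and Complexity from a
   Programming Perspective") on binary trees, whose polynomial-time computable
   functions are those of Turing machines, extended to real inputs in the manner
   of the real RAM: a leaf may hold a real number, which occupies one cell and
   which a program can only add, subtract and compare, at unit cost.  There is
   no unit-cost multiplication, so that on rational inputs t steps lengthen
   numbers by O(t) bits beyond the input and polynomial time in this model gives
   polynomial bit complexity.  The only numeric literal is 1. *)

Inductive data (R : Type) : Type :=
| DNil
| DNum of R
| DCons of data R & data R.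
Arguments DNil {R}.

Fixpoint data_size (R : Type) (d : data R) : nat :=
  match d with
  | DNil | DNum _ => 1
  | DCons d1 d2 => (data_size d1 + data_size d2).+1
  end.

Inductive expr : Type :=
| EVar of nat
| ENil
| EOne
| ECons of expr & expr
| EHd of expr
| ETl of expr
| EAdd of expr & expr
| ESub of expr & expr
| ELe of expr & expr.

Inductive cmd : Type :=
| CSkip
| CAssign of nat & expr
| CSeq of cmd & cmd
| CIf of expr & cmd & cmd
| CWhile of expr & cmd.

(* [DNil] stands for false and every other tree for true. *)
Definition truth (R : Type) (d : data R) : bool :=
  if d is DNil then false else true.

Definition store (R : Type) : Type := nat -> data R.

Definition update (R : Type) (s : store R) (x : nat) (d : data R) : store R :=
  fun y => if y == x then d else s y.

(* Ill-typed operations evaluate to [DNil]. *)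
Fixpoint eval (R : realType) (s : store R) (e : expr) : data R :=
  match e with
  | EVar x => s x
  | ENil => DNil
  | EOne => DNum 1
  | ECons e1 e2 => DCons (eval s e1) (eval s e2)
  | EHd e1 => if eval s e1 is DCons d _ then d else DNil
  | ETl e1 => if eval s e1 is DCons _ d then d else DNil
  | EAdd e1 e2 =>
      if (eval s e1, eval s e2) is (DNum a, DNum b) then DNum (a + b) else DNil
  | ESub e1 e2 =>
      if (eval s e1, eval s e2) is (DNum a, DNum b) then DNum (a - b) else DNil
  | ELe e1 e2 =>
      if (eval s e1, eval s e2) is (DNum a, DNum b) then
        (if a <= b then DCons DNil DNil else DNil)
      else DNil
  end.

Fixpoint expr_cost (e : expr) : nat :=
  match e with
  | EVar _ | ENil | EOne => 1
  | EHd e1 | ETl e1 => (expr_cost e1).+1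
  | ECons e1 e2 | EAdd e1 e2 | ESub e1 e2 | ELe e1 e2 =>
      (expr_cost e1 + expr_cost e2).+1
  end.

(* [exec c s t s']: run from [s], the command [c] halts in [s'] after exactly
   [t] steps. *)
Inductive exec (R : realType) : cmd -> store R -> nat -> store R -> Prop :=
| ExecSkip s : exec CSkip s 1 s
| ExecAssign s x e :
    exec (CAssign x e) s (expr_cost e).+1 (update s x (eval s e))
| ExecSeq s s' s'' c1 c2 t1 t2 :
    exec c1 s t1 s' -> exec c2 s' t2 s'' -> exec (CSeq c1 c2) s (t1 + t2)%N s''
| ExecIfTrue s s' e c1 c2 t :
    truth (eval s e) -> exec c1 s t s' ->
    exec (CIf e c1 c2) s (expr_cost e + t).+1 s'
| ExecIfFalse s s' e c1 c2 t :
    ~~ truth (eval s e) -> exec c2 s t s' ->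
    exec (CIf e c1 c2) s (expr_cost e + t).+1 s'
| ExecWhileFalse s e c :
    ~~ truth (eval s e) -> exec (CWhile e c) s (expr_cost e).+1 s
| ExecWhileTrue s s' s'' e c t1 t2 :
    truth (eval s e) -> exec c s t1 s' -> exec (CWhile e c) s' t2 s'' ->
    exec (CWhile e c) s (expr_cost e + t1 + t2).+1 s''.

(* Input and output are passed in variable 0. *)
Definition runs (R : realType) (c : cmd) (input : data R) (t : nat)
    (output : data R) : Prop :=
  exists s, exec c (update (fun=> DNil) 0%N input) t s /\ s 0%N = output.

Fixpoint encode_seq (R : Type) (s : seq (data R)) : data R :=
  if s is d :: s' then DCons d (encode_seq s') else DNil.

Definition encode_set (R : Type) (T : finType) (f : T -> data R) (A : {set T}) :
    data R :=
  encode_seq [seq f x | x <- enum A].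

Definition encode_nat (R : realType) (n : nat) : data R := DNum n%:R.

(** * Maximization problems and approximation schemes *)

Record max_problem (R : realType) : Type := MaxProblem {
  instance : Type;
  solution : instance -> finType;
  feasible : forall I : instance, solution I -> Prop;
  value : forall I : instance, solution I -> R;
  encode_instance : instance -> data R;
  encode_solution : forall I : instance, solution I -> data R
}.
Arguments feasible {R} _ I S.
Arguments value {R} _ I S.
Arguments encode_instance {R} _ I.
Arguments encode_solution {R} _ I S.

Definition optimal (R : realType) (P : max_problem R) (I : instance P)
    (S : solution I) : Prop :=
  feasible P I S /\ forall S', feasible P I S' -> value P I S' <= value P I S.

(* [DNil] is the answer "there is no feasible solution". *)
Definition approx_answer (R : realType) (P : max_problem R) (eps : R)
    (I : instance P) (output : data R) : Prop :=
  (exists S : solution I,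
     [/\ output = DCons DNil (encode_solution P I S),
         feasible P I S
       & forall Sopt, optimal Sopt ->
           (1 - eps) * value P I Sopt <= value P I S])
  \/ (output = DNil /\ forall S : solution I, ~ feasible P I S).

(* One program serves all [eps]; the polynomial may depend on [eps]. *)
Definition admits_PTAS (R : realType) (P : max_problem R) : Prop :=
  exists c : cmd, forall eps : R, 0 < eps ->
    exists p : {poly nat}, forall I : instance P,
      exists (t : nat) (output : data R),
        [/\ runs c (DCons (DNum eps) (encode_instance P I)) t output,
            (t <= p.[data_size (encode_instance P I)])%N
          & approx_answer eps I output].

(** * Graphs and cuts *)

Record graph (V : finType) : Type := Graph {
  edges :> {set {set V}};
  edges_card2 : forall e, e \in edges -> #|e| = 2
}.

Definition edges_between (V : finType) (G : graph V) (A B : {set V}) :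
    {set {set V}} :=
  [set e in edges G | [exists a in A, exists b in B, e == [set a; b]]].

Definition is_cut (V : finType) (G : graph V) (C : {set {set V}}) : Prop :=
  exists A B : {set V},
    [/\ A != set0, B != set0, A :|: B = [set: V], [disjoint A & B]
      & C = edges_between G A B].

Definition is_min_cut (V : finType) (G : graph V) (C : {set {set V}}) : Prop :=
  is_cut G C /\ forall D, is_cut G D -> (#|C| <= #|D|)%N.

Definition symdiff (T : finType) (A B : {set T}) : {set T} :=
  (A :\: B) :|: (B :\: A).

Definition d_sum (R : realType) (T : finType) (w : T -> R) (k : nat)
    (C : {ffun 'I_k -> {set T}}) : R :=
  \sum_(i < k) \sum_(j < k | (i < j)%N) \sum_(e in symdiff (C i) (C j)) w e.

(** * The problem *)

(* Only the values of [dmc_weight] on edges matter: the encoding lists no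
   others, and cuts consist of edges. *)
Record dmc_instance (R : realType) : Type := DmcInstance {
  dmc_order : nat;
  dmc_graph : graph 'I_dmc_order;
  dmc_weight : {set 'I_dmc_order} -> R;
  dmc_weight_ge0 : forall e, e \in edges dmc_graph -> 0 <= dmc_weight e;
  dmc_k : nat
}.

Definition dmc_solution (R : realType) (I : dmc_instance R) : finType :=
  {ffun 'I_(dmc_k I) -> {set {set 'I_(dmc_order I)}}}.

Definition dmc_feasible (R : realType) (I : dmc_instance R)
    (C : dmc_solution I) : Prop :=
  injective C /\ forall i, is_min_cut (dmc_graph I) (C i).

Definition dmc_value (R : realType) (I : dmc_instance R) (C : dmc_solution I) : R :=
  d_sum (dmc_weight (d := I)) C.

Definition encode_vertex (R : realType) (n : nat) (v : 'I_n) : data R :=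
  encode_nat R v.

Definition encode_edge (R : realType) (n : nat) (e : {set 'I_n}) : data R :=
  encode_set (@encode_vertex R n) e.

(* The vertices are listed explicitly, so that the size of the encoding is
   linear in |V| + |E|. *)
Definition dmc_encode_instance (R : realType) (I : dmc_instance R) : data R :=
  DCons (encode_set (@encode_vertex R (dmc_order I)) [set: 'I_(dmc_order I)])
    (DCons
       (encode_set (fun e => DCons (encode_edge R e) (DNum (dmc_weight e)))
          (edges (dmc_graph I)))
       (encode_nat R (dmc_k I))).

Definition dmc_encode_solution (R : realType) (I : dmc_instance R)
    (C : dmc_solution I) : data R :=
  encode_seq [seq encode_set (@encode_edge R (dmc_order I)) (C i)
             | i <- enum 'I_(dmc_k I)].

Definition diverse_minimum_cuts (R : realType) : max_problem R :=
  @MaxProblem R (dmc_instance R) (@dmc_solution R) (@dmc_feasible R)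
    (@dmc_value R) (@dmc_encode_instance R) (@dmc_encode_solution R).

(* Main.v *)
(** Enumeration of the minimum cuts.  Build [lam * m] spanning forests one after
    the other, where [lam] is the size of a minimum cut and [m] the number of
    edges, each a minimum spanning forest for the load of an edge, that is, the
    number of earlier forests containing it.  A minimum spanning forest carries
    at most a fraction [2 / lam] of the potential [\sum_e 2 ^ load e], because
    the edges of load at least [i] contain [lam] edges leaving each component
    spanned by the others.  Hence the potential stays below
    [m (1 + 2 / lam) ^ (lam * m) <= m 16 ^ m], all loads stay below [5 m], and by
    averaging every minimum cut contains at most four edges of some forest.
    Without these four edges the forest has at most five components, and one
    side of the cut is the union of at most two of them.  This leaves
    polynomially many candidates.

    Selection of [k] minimum cuts.  Weighted Hamming distance is of negative
    type, so a set of [k] points which no swap of one point improves is within a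
    factor [1 - O(1 / k)] of the optimum (Cevallos, Eisenbrand and Zenklusen).
    A round of best swaps that gains at most [1 / k ^ 2] of the optimum is
    almost as good as a local optimum, and one of [k ^ 2] rounds is such.  This
    settles [k >= 12 / eps]; for smaller [k] all [k]-subsets can be tried. *)

Require Import Defs.
From mathcomp Require Import all_boot all_order all_algebra.
From mathcomp Require Import reals.
From mathcomp Require Import zify ring lra.

Set Implicit Arguments.
Unset Strict Implicit.
Unset Printing Implicit Defensive.

Import Order.TTheory GRing.Theory Num.Theory.

(** * Programs on encoded data *)

(** One program has to serve every eps, and it can neither multiply nor divide. So 12 / eps enters
    only through a running sum of eps along a prefix of a selection. This prefix, shorter than 12 /
    eps + 1, also fixes the depth of the exhaustive search, the only stage whose polynomial depends
    on eps. Nor is lam known to the program: it builds (m + 1) ^ 2 >= lam * m forests, and the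
    analysis looks at the first lam * m.

    Why local optima are good: let O be optimal, S the set found, D(S) = [cross S S] and g =
    cross(O, S) - D(S). Negative type gives D(O) - D(S) <= 2 g. Let X = O \ S and Y = S \ O have r
    points each. Adding up the failed swaps over X and Y gives r g <= cross(X, Y), and the triangle
    inequality through the points of O gives k cross(X, Y) <= r (D(O) + cross(O, S)). Hence (k - 1)
    g <= 2 D(O). Allowing a gain of D(O) / k ^ 2 per swap raises the loss from 4 D(O) / (k - 1) to 5
    D(O) / (k - 1) <= 10 D(O) / k, so 12 leaves some room. *)

Class Enc (R : realType) (A : Type) := enc : A -> data R.
#[export] Hint Mode Enc - ! : typeclass_instances.

Section Instances.
Variable R : realType.

#[export] Instance enc_bool : Enc R bool :=
  fun b => if b then DCons DNil DNil else DNil.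
#[export] Instance enc_nat : Enc R nat := fun n => DNum n%:R%R.
#[export] Instance enc_num : Enc R (Real.sort R) := fun r => DNum r.
#[export] Instance enc_prod A B {EA : Enc R A} {EB : Enc R B} :
  Enc R (A * B) := fun p => DCons (enc p.1) (enc p.2).
#[export] Instance enc_seq A {EA : Enc R A} : Enc R (seq A) :=
  fun s => encode_seq [seq enc x | x <- s].
#[export] Instance enc_option A {EA : Enc R A} : Enc R (option A) :=
  fun o => if o is Some x then DCons DNil (enc x) else DNil.

End Instances.

Definition esize (R : realType) A {EA : Enc R A} (a : A) : nat :=
  data_size (enc a).

(** The base [n.+2] is at least 2, so that constants and sums are absorbed by a larger exponent.
    Monotonicity allows a size to be replaced by a bound on it. *)
Definition poly_bound (T : nat -> nat) : Prop :=
  (exists d, forall n, T n <= n.+2 ^ d) /\ {homo T : m n / m <= n}.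

(* The program [c b] reads its input and writes its output in variable [b] and
   may change only the variables from [b] on, which makes programs composable. *)
Definition implements (R : realType) A B {EA : Enc R A} {EB : Enc R B}
    (c : nat -> cmd) (f : A -> B) (T : A -> nat) : Prop :=
  forall b (s : store R) a, s b = enc a -> exists t s',
    [/\ exec (c b) s t s', s' b = enc (f a), forall y, y < b -> s' y = s y
      & t + esize (f a) <= T a].

(** Since [implements] charges the size of the output along with the time, [T] also bounds the input
    of whatever program runs next. *)
Definition polytime (R : realType) A B {EA : Enc R A} {EB : Enc R B}
    (f : A -> B) : Prop :=
  exists c T, poly_bound T /\ implements c f (fun a => T (esize a)).

Section PolyBound.

Lemma leq_expn2r m n d : m <= n -> m ^ d <= n ^ d.
Proof. by case: d => // d mn; rewrite leq_exp2r. Qed.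

Lemma poly_bound_id : poly_bound id.
Proof. by split=> //; exists 1 => n; rewrite expn1; lia. Qed.

Lemma poly_bound_const k : poly_bound (fun=> k).
Proof.
split=> //; exists k => n.
by apply: leq_trans (ltnW (ltn_expl k (isT : 1 < 2))) _; apply: leq_expn2r.
Qed.

Lemma poly_bound_add S T :
  poly_bound S -> poly_bound T -> poly_bound (fun n => S n + T n).
Proof.
move=> [[d Sd] Sh] [[e Te] Th]; split; last first.
  by move=> m n mn; rewrite leq_add ?Sh ?Th.
exists (maxn d e).+1 => n.
apply: (@leq_trans (n.+2 ^ maxn d e + n.+2 ^ maxn d e)).
  rewrite leq_add // (leq_trans (Sd n), leq_trans (Te n)) //;
    by rewrite leq_pexp2l // (leq_maxl, leq_maxr).
by rewrite addnn -mul2n expnS leq_mul2r orbC.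
Qed.

Lemma poly_bound_mul S T :
  poly_bound S -> poly_bound T -> poly_bound (fun n => S n * T n).
Proof.
move=> [[d Sd] Sh] [[e Te] Th]; split; last first.
  by move=> m n mn; rewrite leq_mul ?Sh ?Th.
by exists (d + e) => n; rewrite expnD leq_mul.
Qed.

Lemma poly_bound_comp S T :
  poly_bound S -> poly_bound T -> poly_bound (fun n => S (T n)).
Proof.
move=> [[d Sd] Sh] [[e Te] Th]; split; last by move=> m n mn; rewrite Sh ?Th.
(* With x = n + 2, the base at [T n] is at most x ^ e + 2 <= 4 x ^ e <= x ^ (e + 2). *)
exists (e.+2 * d) => n; apply: leq_trans (Sd _) _; rewrite expnM; apply: leq_expn2r.
rewrite !expnS; have := Te n; have : 0 < n.+2 ^ e by rewrite expn_gt0.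
nia.
Qed.

End PolyBound.

(** * Program constructions and their exact costs *)

Section Programs.
Variable R : realType.
Implicit Types (s : store R) (b : nat).

Lemma esize_gt0 A {EA : Enc R A} (a : A) : 0 < esize a.
Proof. by rewrite /esize; case: (enc a). Qed.

Lemma esize_pair A B {EA : Enc R A} {EB : Enc R B} (p : A * B) :
  esize p = (esize p.1 + esize p.2).+1.
Proof. by []. Qed.

Lemma esize_cons A {EA : Enc R A} (x : A) (s : seq A) :
  esize (x :: s) = (esize x + esize s).+1.
Proof. by []. Qed.

Lemma update_same s x d : update s x d x = d.
Proof. by rewrite /update eqxx. Qed.

Lemma update_other s x d y : y != x -> update s x d y = s y.
Proof. by rewrite /update => /negbTE->. Qed.

Definition assign_prog (e : nat -> expr) b := CAssign b (e b).

Lemma implements_expr A B {EA : Enc R A} {EB : Enc R B} (f : A -> B)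
    (e : nat -> expr) k :
  (forall b s a, s b = enc a -> eval s (e b) = enc (f a)) ->
  (forall b, expr_cost (e b) < k) ->
  implements (assign_prog e) f (fun a => k + esize (f a)).
Proof.
move=> ef ck b s a sb; exists (expr_cost (e b)).+1, (update s b (eval s (e b))).
split; first exact: ExecAssign; last by rewrite leq_add2r.
  by rewrite update_same; apply: ef.
by move=> y yb; rewrite update_other // neq_ltn yb.
Qed.

Definition comp_prog (c1 c2 : nat -> cmd) b := CSeq (c1 b) (c2 b).

Lemma implements_comp A B C {EA : Enc R A} {EB : Enc R B} {EC : Enc R C}
    (f : A -> B) (g : B -> C) c1 c2 S T :
  implements c1 f S -> implements c2 g T ->
  implements (comp_prog c1 c2) (fun a => g (f a)) (fun a => S a + T (f a)).
Proof.
move=> If Ig b s a sb.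
have [t [s' [E s'b F L]]] := If b s a sb.
have [u [s'' [E' s''b F' L']]] := Ig b s' (f a) s'b.
exists (t + u), s''; split=> //; first exact: ExecSeq E E'; last by lia.
by move=> y yb; rewrite F' // F.
Qed.

Definition pair_prog (c1 c2 : nat -> cmd) b :=
  CSeq (CAssign b.+1 (EVar b)) (CSeq (c1 b.+1)
 (CSeq (CAssign b.+2 (EVar b)) (CSeq (c2 b.+2)
  (CAssign b (ECons (EVar b.+1) (EVar b.+2)))))).

Lemma implements_pair A B C {EA : Enc R A} {EB : Enc R B} {EC : Enc R C}
    (f : A -> B) (g : A -> C) c1 c2 S T :
  implements c1 f S -> implements c2 g T ->
  implements (pair_prog c1 c2) (fun a => (f a, g a))
    (fun a => S a + T a + 9).
Proof.
move=> If Ig b s a sb; rewrite /pair_prog.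
have [t [s1 [E1 s1b F1 L1]]] := If b.+1 (update s b.+1 (s b)) a
  ltac:(by rewrite update_same).
have s1b0 : s1 b = enc a by rewrite F1 // update_other // neq_ltn ltnSn.
have [u [s2 [E2 s2b F2 L2]]] := Ig b.+2 (update s1 b.+2 (s1 b)) a
  ltac:(by rewrite update_same).
have s2b1 : s2 b.+1 = enc (f a).
  by rewrite F2 // update_other // neq_ltn ltnSn.
pose s3 := update s2 b (eval s2 (ECons (EVar b.+1) (EVar b.+2))).
exists (2 + (t + (2 + (u + 4)))), s3; split.
- apply: ExecSeq; first exact: ExecAssign.
  apply: ExecSeq; first exact: E1.
  apply: ExecSeq; first exact: ExecAssign.
  apply: ExecSeq; first exact: E2.
  exact: ExecAssign.
- by rewrite /s3 update_same /= s2b1 s2b.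
- move=> y yb; rewrite /s3 update_other; last by rewrite neq_ltn yb.
  rewrite F2 ?update_other ?F1 ?update_other //; try lia.
- by move: L1 L2; rewrite esize_pair /=; lia.
Qed.

Definition if_prog (c c1 c2 : nat -> cmd) b :=
  CSeq (CAssign b.+1 (EVar b)) (CSeq (c b.+1)
  (CIf (EVar b.+1) (c1 b) (c2 b))).

Lemma implements_if A B {EA : Enc R A} {EB : Enc R B}
    (p : A -> bool) (f g : A -> B) c c1 c2 S T U :
  implements c p S -> implements c1 f T -> implements c2 g U ->
  implements (if_prog c c1 c2) (fun a => if p a then f a else g a)
    (fun a => S a + T a + U a + 9).
Proof.
move=> Ip If Ig b s a sb; rewrite /if_prog.
have [t [s1 [E1 s1b F1 L1]]] := Ip b.+1 (update s b.+1 (s b)) a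
  ltac:(by rewrite update_same).
have s1b0 : s1 b = enc a by rewrite F1 // update_other // neq_ltn ltnSn.
have s1y y : y < b -> s1 y = s y.
  by move=> yb; rewrite F1 ?update_other //; lia.
case pa: (p a) s1b => s1b.
- have [u [s2 [E2 s2b F2 L2]]] := If b s1 a s1b0.
  exists (2 + (t + (1 + u).+1)), s2; split=> //.
  + apply: ExecSeq; first exact: ExecAssign.
    apply: ExecSeq; first exact: E1.
    by apply: ExecIfTrue; rewrite //= s1b.
  + by move=> y yb; rewrite F2 // s1y.
  + lia.
- have [u [s2 [E2 s2b F2 L2]]] := Ig b s1 a s1b0.
  exists (2 + (t + (1 + u).+1)), s2; split=> //.
  + apply: ExecSeq; first exact: ExecAssign.
    apply: ExecSeq; first exact: E1.
    by apply: ExecIfFalse; rewrite //= s1b.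
  + by move=> y yb; rewrite F2 // s1y.
  + lia.
Qed.

(** Variable [b] keeps the environment, [b.+1] the rest of the list and [b.+2] the accumulator. The
    step runs from [b.+3] on, where it cannot disturb them. *)
Definition fold_body (c : nat -> cmd) b :=
  CSeq (CAssign b.+3 (ECons (EVar b) (ECons (EVar b.+2) (EHd (EVar b.+1)))))
 (CSeq (c b.+3)
 (CSeq (CAssign b.+2 (EVar b.+3)) (CAssign b.+1 (ETl (EVar b.+1))))).

Definition fold_prog (c0 cl c : nat -> cmd) b :=
  CSeq (CAssign b.+1 (EVar b)) (CSeq (cl b.+1)
 (CSeq (CAssign b.+2 (EVar b)) (CSeq (c0 b.+2)
 (CSeq (CWhile (EVar b.+1) (fold_body c b)) (CAssign b (EVar b.+2)))))).

Section Fold.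
Context A B C {EA : Enc R A} {EB : Enc R B} {EC : Enc R C}.
Variables (step : A -> B -> C -> B) (c : nat -> cmd) (T : A * (B * C) -> nat).
Hypothesis Istep : implements c (fun p => step p.1 p.2.1 p.2.2) T.

(** [M] has to bound only the steps of this very run, because accumulators are known to be small
    only along it. *)
Lemma exec_fold_loop b s a acc l M :
  s b = enc a -> s b.+1 = enc l -> s b.+2 = enc acc ->
  (forall l1 x l2, l = l1 ++ x :: l2 ->
     T (a, (foldl (step a) acc l1, x)) <= M) ->
  exists t s', [/\ exec (CWhile (EVar b.+1) (fold_body c b)) s t s',
    s' b.+2 = enc (foldl (step a) acc l), forall y, y < b -> s' y = s y
    & t <= size l * (M + 16) + 2].
Proof.
elim: l s acc => [|x l IH] s acc sa sl sacc TM.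
  exists 2, s; split=> //; first by apply: ExecWhileFalse; rewrite /= sl.
have [t [s1 [E1 s1b F1 L1]]] := Istep (update_same s b.+3 (enc (a, (acc, x)))).
pose s2 := update s1 b.+2 (s1 b.+3).
pose s3 := update s2 b.+1 (@enc _ _ (@enc_seq R C EC) l).
have s1y y : y < b.+3 -> s1 y = s y.
  by move=> yb; rewrite F1 // update_other //; lia.
have s3y y : y < b.+1 -> s3 y = s y.
  by move=> yb; rewrite /s3 /s2 !update_other ?s1y //; lia.
have [u [s4 [E4 s4b F4 L4]]] : exists t s',
    [/\ exec (CWhile (EVar b.+1) (fold_body c b)) s3 t s',
    s' b.+2 = enc (foldl (step a) (step a acc x) l),
    forall y, y < b -> s' y = s3 y
    & t <= size l * (M + 16) + 2].
  apply: IH.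
  - by rewrite s3y.
  - by rewrite /s3 update_same.
  - by rewrite /s3 /s2 update_other ?update_same //; lia.
  - by move=> l1 z l2 e; apply: (TM (x :: l1) z l2); rewrite e.
exists (1 + (7 + (t + (2 + 3))) + u).+1, s4; split=> //.
- apply: ExecWhileTrue E4; first by rewrite /= sl.
  apply: ExecSeq.
    have := @ExecAssign R s b.+3
      (ECons (EVar b) (ECons (EVar b.+2) (EHd (EVar b.+1)))).
    by rewrite /= sa sl sacc; apply.
  apply: ExecSeq; first exact: E1.
  apply: ExecSeq; first exact: ExecAssign.
  have := @ExecAssign R s2 b.+1 (ETl (EVar b.+1)).
  have -> : eval s2 (ETl (EVar b.+1)) = enc l.
    by rewrite /= /s2 update_other ?s1y ?sl //; lia.
  by apply.
- by move=> y yb; rewrite F4 // s3y //; lia.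
- have := TM [::] x l erefl; rewrite /= in L1 *; lia.
Qed.

Lemma implements_foldl (i : A -> B) (l : A -> seq C) c0 cl S U M :
  implements c0 i S -> implements cl l U ->
  (forall a l1 x l2, l a = l1 ++ x :: l2 ->
     T (a, (foldl (step a) (i a) l1, x)) <= M a) ->
  implements (fold_prog c0 cl c) (fun a => foldl (step a) (i a) (l a))
    (fun a => S a + U a + esize (l a) * (M a + 16)
              + esize (foldl (step a) (i a) (l a)) + 8).
Proof.
move=> Ii Il TM b s a sb; rewrite /fold_prog.
have [t [s1 [E1 s1b F1 L1]]] := Il b.+1 (update s b.+1 (s b)) a
  ltac:(by rewrite update_same).
have s1y y : y < b.+1 -> s1 y = s y.
  by move=> yb; rewrite F1 ?update_other //; lia.
have s1b0 : s1 b = enc a by rewrite s1y.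
have [u [s2 [E2 s2b F2 L2]]] := Ii b.+2 (update s1 b.+2 (s1 b)) a
  ltac:(by rewrite update_same).
have s2y y : y < b.+2 -> s2 y = s1 y.
  by move=> yb; rewrite F2 ?update_other //; lia.
have [v [s3 [E3 s3b F3 L3]]] := @exec_fold_loop b s2 a (i a) (l a) (M a)
  ltac:(by rewrite s2y) ltac:(by rewrite s2y) s2b (@TM a).
exists (2 + (t + (2 + (u + (v + 2))))), (update s3 b (s3 b.+2)); split.
- apply: ExecSeq; first exact: ExecAssign.
  apply: ExecSeq; first exact: E1.
  apply: ExecSeq; first exact: ExecAssign.
  apply: ExecSeq; first exact: E2.
  apply: ExecSeq; first exact: E3.
  exact: ExecAssign.
- by rewrite update_same.
- move=> y yb; rewrite update_other; last by lia.
  by rewrite F3 // s2y ?s1y //; lia.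
- have : size (l a) <= esize (l a).
    by elim: (l a) => //= x l' IH; rewrite esize_cons; lia.
  move: L1 L2 L3; nia.
Qed.

End Fold.

End Programs.

Ltac poly_bound := repeat (cbv beta; first
  [ exact: poly_bound_id | exact: poly_bound_const | assumption
  | apply: poly_bound_add | apply: poly_bound_mul
  | match goal with H : poly_bound ?T |- poly_bound (fun n => ?T (@?S n)) =>
      exact: H || (apply: (@poly_bound_comp T S H)) end ]).

(** * Closure properties of polynomial time *)

Section Rules.
Variable R : realType.

Lemma implements_weaken A B {EA : Enc R A} {EB : Enc R B} c (f g : A -> B) S T :
  f =1 g -> (forall a, S a <= T a) -> implements c f S -> implements c g T.
Proof.
move=> fg ST If b s a sb; have [t [s' [E s'b F L]]] := If b s a sb.
by exists t, s'; split; rewrite -?fg //; apply: leq_trans L (ST a).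
Qed.

Section Basic.
Context A B {EA : Enc R A} {EB : Enc R B}.

Lemma polytime_ext (f g : A -> B) : f =1 g -> polytime f -> polytime g.
Proof.
move=> fg [c [T [pT If]]]; exists c, T; split=> //.
exact: implements_weaken fg _ If.
Qed.

Lemma polytime_expr (f : A -> B) (e : nat -> expr) k G :
  poly_bound G -> (forall a, esize (f a) <= G (esize a)) ->
  (forall b s a, s b = enc a -> eval s (e b) = enc (f a)) ->
  (forall b, expr_cost (e b) < k) -> polytime f.
Proof.
move=> pG fG ef ek; exists (assign_prog e), (fun n => k + G n).
split; first by poly_bound.
by apply: implements_weaken (implements_expr ef ek) => // a; rewrite leq_add2l.
Qed.

End Basic.

Lemma polytime_id A {EA : Enc R A} : polytime (fun a : A => a).
Proof. by apply: (@polytime_expr _ _ _ _ _ EVar 2 id poly_bound_id). Qed.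

Lemma polytime_comp A B C {EA : Enc R A} {EB : Enc R B} {EC : Enc R C}
    (g : B -> C) (f : A -> B) :
  polytime g -> polytime f -> polytime (fun a => g (f a)).
Proof.
move=> [c2 [T [pT Ig]]] [c1 [S [pS If]]].
exists (comp_prog c1 c2), (fun n => S n + T (S n)); split; first by poly_bound.
apply: implements_weaken (implements_comp If Ig) => // a.
rewrite leq_add2l; apply: pT.2; case: (If 0 (fun=> enc a) a erefl) => t [s].
by case=> _ _ _; apply: leq_trans; rewrite leq_addl.
Qed.

Lemma polytime_implements A B {EA : Enc R A} {EB : Enc R B} (f : A -> B) :
  polytime f ->
  exists c T, poly_bound T /\ implements c f (fun a => T (esize a)).
Proof. by []. Qed.

Lemma polytime_size A B {EA : Enc R A} {EB : Enc R B} (f : A -> B) :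
  polytime f ->
  exists T, poly_bound T /\ forall a, esize (f a) <= T (esize a).
Proof.
move=> [c [T [pT If]]]; exists T; split=> // a.
have [t [s [_ _ _]]] := If 0 (fun=> enc a) a erefl.
by apply: leq_trans; rewrite leq_addl.
Qed.

Section InContext.
Context G {EG : Enc R G}.

Section Pairs.
Context A B {EA : Enc R A} {EB : Enc R B}.

Lemma polytime_pair (f : G -> A) (g : G -> B) :
  polytime f -> polytime g -> polytime (fun x => (f x, g x)).
Proof.
move=> [c1 [S [pS If]]] [c2 [T [pT Ig]]].
exists (pair_prog c1 c2), (fun n => S n + T n + 9); split; first by poly_bound.
exact: implements_pair If Ig.
Qed.

Lemma polytime_fst (f : G -> A * B) : polytime f -> polytime (fun x => (f x).1).
Proof.
apply: polytime_comp.
apply: (@polytime_expr _ _ _ _ _ (fun b => EHd (EVar b)) 3 id).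
- exact: poly_bound_id.
- by move=> a; rewrite esize_pair; lia.
- by move=> b s a /= ->.
- by [].
Qed.

Lemma polytime_snd (f : G -> A * B) : polytime f -> polytime (fun x => (f x).2).
Proof.
apply: polytime_comp.
apply: (@polytime_expr _ _ _ _ _ (fun b => ETl (EVar b)) 3 id).
- exact: poly_bound_id.
- by move=> a; rewrite esize_pair; lia.
- by move=> b s a /= ->.
- by [].
Qed.

Lemma polytime_if (p : G -> bool) (f g : G -> A) :
  polytime p -> polytime f -> polytime g ->
  polytime (fun x => if p x then f x else g x).
Proof.
move=> [c [S [pS Ip]]] [c1 [T [pT If]]] [c2 [U [pU Ig]]].
exists (if_prog c c1 c2), (fun n => S n + T n + U n + 9).
split; first by poly_bound.
exact: implements_if Ip If Ig.
Qed.

Lemma polytime_nil : polytime (fun _ : G => [::] : seq A).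
Proof.
by apply: (@polytime_expr _ _ _ _ _ (fun=> ENil) 2 (fun=> 1)) => //; poly_bound.
Qed.

Lemma polytime_cons (f : G -> A) (g : G -> seq A) :
  polytime f -> polytime g -> polytime (fun x => f x :: g x).
Proof.
move=> pf pg.
apply: (@polytime_comp _ (A * seq A) _ _ _ _ (fun p => p.1 :: p.2)
   (fun x => (f x, g x))); last first.
  move: pf pg => [c1 [S [pS If]]] [c2 [T [pT Ig]]].
  exists (pair_prog c1 c2), (fun n => S n + T n + 9); split; first by poly_bound.
  exact: implements_pair If Ig.
apply: (@polytime_expr _ _ _ _ _ EVar 2 id) => //; exact: poly_bound_id.
Qed.

Lemma polytime_none : polytime (fun _ : G => None : option A).
Proof.
by apply: (@polytime_expr _ _ _ _ _ (fun=> ENil) 2 (fun=> 1)) => //; poly_bound.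
Qed.

Lemma polytime_some (f : G -> A) : polytime f -> polytime (fun x => Some (f x)).
Proof.
apply: polytime_comp.
apply: (@polytime_expr _ _ _ _ _ (fun b => ECons ENil (EVar b)) 4
          (fun n => n + 2)).
- poly_bound.
- by move=> a; rewrite /esize /=; lia.
- by move=> b s a /= ->.
- by [].
Qed.

End Pairs.

Lemma polytime_true : polytime (fun _ : G => true).
Proof.
apply: (@polytime_expr _ _ _ _ _ (fun=> ECons ENil ENil) 4 (fun=> 3)) => //.
poly_bound.
Qed.

Lemma polytime_false : polytime (fun _ : G => false).
Proof.
by apply: (@polytime_expr _ _ _ _ _ (fun=> ENil) 4 (fun=> 3)) => //; poly_bound.
Qed.

Lemma polytime_and (p q : G -> bool) :
  polytime p -> polytime q -> polytime (fun x => p x && q x).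
Proof. by move=> pp pq; exact: polytime_if pp pq polytime_false. Qed.

Lemma polytime_or (p q : G -> bool) :
  polytime p -> polytime q -> polytime (fun x => p x || q x).
Proof. by move=> pp pq; exact: polytime_if pp polytime_true pq. Qed.

Lemma polytime_not (p : G -> bool) : polytime p -> polytime (fun x => ~~ p x).
Proof. by move=> pp; exact: polytime_if pp polytime_false polytime_true. Qed.

End InContext.

Definition bin_expr (op : expr -> expr -> expr) b :=
  op (EHd (EVar b)) (ETl (EVar b)).

Lemma polytime_binop A B C {EA : Enc R A} {EB : Enc R B} {EC : Enc R C}
    G {EG : Enc R G} (h : A -> B -> C) op k (f : G -> A) (g : G -> B) :
  (forall s e1 e2 x y, eval s e1 = enc x -> eval s e2 = enc y ->
     eval s (op e1 e2) = enc (h x y)) ->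
  (forall x y, esize (h x y) <= k) ->
  (forall b, expr_cost (bin_expr op b) < k) ->
  polytime f -> polytime g -> polytime (fun x => h (f x) (g x)).
Proof.
move=> hop hk ck pf pg.
apply: (@polytime_comp _ (A * B) _ _ _ _ (fun p => h p.1 p.2)
   (fun x => (f x, g x))); last exact: polytime_pair.
apply: (@polytime_expr _ _ _ _ _ (bin_expr op) k (fun=> k)) => //.
  poly_bound.
by move=> b s a sb; apply: hop; rewrite /= sb.
Qed.

Section Arithmetic.
Context G {EG : Enc R G}.

Lemma polytime_addn (f g : G -> nat) :
  polytime f -> polytime g -> polytime (fun x => f x + g x).
Proof.
apply: (polytime_binop (op := EAdd) (k := 6)) => // s e1 e2 x y /= -> ->.
by rewrite /enc /enc_nat natrD.
Qed.

Lemma polytime_leq (f g : G -> nat) :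
  polytime f -> polytime g -> polytime (fun x => f x <= g x).
Proof.
apply: (polytime_binop (op := ELe) (k := 6)) => // [s e1 e2 x y /= -> ->|].
  by rewrite /enc /enc_nat ler_nat; case: (_ <= _).
by move=> x y; case: (x <= y).
Qed.

Lemma polytime_one : polytime (fun _ : G => 1).
Proof.
by apply: (@polytime_expr _ _ _ _ _ (fun=> EOne) 4 (fun=> 1)) => //; poly_bound.
Qed.

Lemma polytime_zero : polytime (fun _ : G => 0).
Proof.
apply: (@polytime_expr _ _ _ _ _ (fun=> ESub EOne EOne) 4 (fun=> 1)) => //.
  poly_bound.
by move=> b s a _; rewrite /= subrr.
Qed.

Lemma polytime_succ (f : G -> nat) : polytime f -> polytime (fun x => (f x).+1).
Proof.
move=> pf; apply: polytime_ext (polytime_addn polytime_one pf) => x.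
by rewrite add1n.
Qed.

Lemma polytime_eqn (f g : G -> nat) :
  polytime f -> polytime g -> polytime (fun x => f x == g x).
Proof.
move=> pf pg.
apply: polytime_ext (polytime_and (polytime_leq pf pg) (polytime_leq pg pf)) => x.
by rewrite eqn_leq.
Qed.

Lemma polytime_addr (f g : G -> R) :
  polytime f -> polytime g -> polytime (fun x => (f x + g x)%R).
Proof.
by apply: (polytime_binop (op := EAdd) (k := 6)) => // s e1 e2 x y /= -> ->.
Qed.

Lemma polytime_ler (f g : G -> R) :
  polytime f -> polytime g -> polytime (fun x => (f x <= g x)%R).
Proof.
apply: (polytime_binop (op := ELe) (k := 6)) => // [s e1 e2 x y /= -> ->|] //.
by move=> x y; case: (x <= y)%R.
Qed.

Lemma polytime_zeror : polytime (fun _ : G => 0%R : R).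
Proof.
apply: (@polytime_expr _ _ _ _ _ (fun=> ESub EOne EOne) 4 (fun=> 1)) => //.
  poly_bound.
by move=> b s a _; rewrite /= subrr.
Qed.

Lemma polytime_natr (f : G -> nat) : polytime f ->
  polytime (fun x => (f x)%:R%R : R).
Proof.
apply: (polytime_comp (g := fun n => n%:R%R : R)).
apply: (@polytime_expr _ _ _ _ _ EVar 2 id) => //; exact: poly_bound_id.
Qed.

End Arithmetic.

Definition match_prog (cs cf ch : nat -> cmd) b :=
  CSeq (CAssign b.+1 (EVar b)) (CSeq (cs b.+1)
  (CIf (EVar b.+1)
     (CSeq (CAssign b (ECons (EVar b) (EVar b.+1))) (ch b)) (cf b))).

Section Lists.
Context G {EG : Enc R G}.

(** A nonempty list has the same encoding as the pair of its head and tail, so consing the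
    environment onto the list is already the input of [h], and [DNil] makes emptiness testable by
    [CIf]. *)
Lemma polytime_match A B {EA : Enc R A} {EB : Enc R B}
    (s : G -> seq A) (f : G -> B) (h : G -> A -> seq A -> B) :
  polytime s -> polytime f ->
  polytime (fun p : G * (A * seq A) => h p.1 p.2.1 p.2.2) ->
  polytime (fun x => if s x is a :: r then h x a r else f x).
Proof.
move=> [cs [S [pS Is]]] [cf [T [pT If]]] [ch [U [pU Ih]]].
exists (match_prog cs cf ch), (fun n => S n + T n + U (n + S n + 1) + 15).
split; first by poly_bound.
move=> b st x stb; rewrite /match_prog.
have [t [s1 [E1 s1b F1 L1]]] := Is b.+1 (update st b.+1 (st b)) x
  ltac:(by rewrite update_same).
have s1y y : y < b.+1 -> s1 y = st y.
  by move=> yb; rewrite F1 ?update_other //; lia.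
have s1b0 : s1 b = enc x by rewrite s1y.
case sx: (s x) s1b L1 => [|a r] s1b L1.
- have [u [s2 [E2 s2b F2 L2]]] := If b s1 x s1b0.
  exists (2 + (t + (1 + u).+1)), s2; split=> //.
  + apply: ExecSeq; first exact: ExecAssign.
    apply: ExecSeq; first exact: E1.
    by apply: ExecIfFalse; rewrite //= s1b.
  + by move=> y yb; rewrite F2 // s1y //; lia.
  + lia.
- have [u [s2 [E2 s2b F2 L2]]] := Ih b
    (update s1 b (eval s1 (ECons (EVar b) (EVar b.+1)))) (x, (a, r))
    ltac:(by rewrite update_same /= s1b0 s1b).
  exists (2 + (t + (1 + (4 + u)).+1)), s2; split=> //.
  + apply: ExecSeq; first exact: ExecAssign.
    apply: ExecSeq; first exact: E1.
    apply: ExecIfTrue; first by rewrite /= s1b.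
    apply: ExecSeq; first exact: ExecAssign.
    exact: E2.
  + by move=> y yb; rewrite F2 // update_other ?s1y //; lia.
  + have : U (esize (x, (a, r))) <= U (esize x + S (esize x) + 1).
      by apply: pU.2; move: L1; rewrite !esize_pair /= esize_cons; lia.
    by rewrite /= in L2; lia.
Qed.

Lemma esize_mem (A : eqType) {EA : Enc R A} (s : seq A) a :
  a \in s -> esize a < esize s.
Proof.
elim: s => //= x s IH; rewrite inE esize_cons => /orP[/eqP->|/IH]; lia.
Qed.

Lemma esize_mid A {EA : Enc R A} (s1 s2 : seq A) a :
  esize a < esize (s1 ++ a :: s2).
Proof. by elim: s1 => [|x s1 IH] /=; rewrite esize_cons; lia. Qed.

Lemma esize_cat A {EA : Enc R A} (s1 s2 : seq A) :
  (esize (s1 ++ s2)).+1 = esize s1 + esize s2.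
Proof. by elim: s1 => [|x s1 IH] //=; rewrite !esize_cons; lia. Qed.

Lemma size_esize A {EA : Enc R A} (s : seq A) : size s < esize s.
Proof. by elim: s => //= x s IH; rewrite esize_cons; lia. Qed.

Section Foldl.
Context A B {EA : Enc R A} {EB : Enc R B}.
Variables (l : G -> seq A) (i : G -> B) (step : G -> B -> A -> B).
Hypotheses (pl : polytime l) (pi : polytime i).
Hypothesis pstep : polytime (fun p : G * (B * A) => step p.1 p.2.1 p.2.2).

(** A polynomial-time step could square the accumulator in every round, so a bound [H] on all
    intermediate accumulators has to be supplied. *)
Lemma polytime_foldl H :
  poly_bound H ->
  (forall x l1 l2, l x = l1 ++ l2 ->
     esize (foldl (step x) (i x) l1) <= H (esize x)) ->
  polytime (fun x => foldl (step x) (i x) (l x)).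
Proof.
move=> pH Hf; have [Sl [pSl lS]] := polytime_size pl.
case: pl pi pstep => [cl [U [pU Il]]] [c0 [S [pS Ii]]] [c [T [pT Is]]].
pose M n := T (n + H n + Sl n + 2).
exists (fold_prog c0 cl c),
   (fun n => S n + U n + Sl n * (M n + 16) + H n + 8).
split; first by rewrite /M; poly_bound.
apply: implements_weaken
  (implements_foldl (M := fun x => M (esize x)) Is Ii Il _) => // [x|x l1 a l2 e].
  have := Hf x (l x) [::]; rewrite cats0 => /(_ erefl).
  move=> h; rewrite leq_add2r leq_add // leq_add2l.
  by rewrite leq_mul2r lS orbT.
apply: pT.2; rewrite !esize_pair /=.
have := Hf x l1 (a :: l2) e; have := lS x; have := esize_mid (EA := EA) l1 l2 a.
rewrite e; lia.
Qed.

(** Growth by an amount that ignores the accumulator adds up to at most the length of the list times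
    a single polynomial. *)
Lemma polytime_foldl_add D :
  poly_bound D ->
  (forall x acc a, esize (step x acc a) <= esize acc + D (esize x + esize a)) ->
  polytime (fun x => foldl (step x) (i x) (l x)).
Proof.
move=> pD hD; have [Sl [pSl lS]] := polytime_size pl.
have [Si [pSi iS]] := polytime_size pi.
apply: (@polytime_foldl (fun n => Si n + Sl n * D (n + Sl n))).
  poly_bound.
move=> x l1 l2 e.
have : forall l1 l2, l x = l1 ++ l2 ->
  esize (foldl (step x) (i x) l1) <=
    Si (esize x) + size l1 * D (esize x + Sl (esize x)).
  move=> {l1 l2 e}; elim/last_ind => [|l1 a IH] l2 e.
    by rewrite mul0n addn0 iS.
  rewrite -cats1 foldl_cat /= size_cat addn1 mulSn addnCA.
  have := IH (a :: l2); rewrite -cats1 -catA /= in e; rewrite e => /(_ erefl).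
  have := hD x (foldl (step x) (i x) l1) a.
  have : D (esize x + esize a) <= D (esize x + Sl (esize x)).
    apply: pD.2; rewrite leq_add2l (leq_trans _ (lS x)) //.
    by rewrite e; apply/ltnW/esize_mid.
  by move=> h1 h2 h3; rewrite (leq_trans h2) // addnC leq_add.
move=> /(_ l1 l2 e) h; apply: leq_trans h _; rewrite leq_add2l leq_mul2r.
apply/orP; right.
apply: (@leq_trans (size (l x))); first by rewrite e size_cat leq_addr.
exact: leq_trans (ltnW (size_esize _)) (lS x).
Qed.

(** Meant for numeric accumulators: a number occupies one cell whatever its value. *)
Lemma polytime_foldl_const k :
  (forall acc : B, esize acc <= k) ->
  polytime (fun x => foldl (step x) (i x) (l x)).
Proof.
move=> hk; apply: (@polytime_foldl_add (fun=> k)) => [|x acc a].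
  exact: poly_bound_const.
by apply: leq_trans (hk _) (leq_addl _ _).
Qed.

End Foldl.

End Lists.

End Rules.

(* Unifying two polytime statements up to unfolding would not terminate in
   reasonable time. *)
#[global] Opaque polytime.

(** * Polynomial-time list functions *)

Definition polytime_eq (R : realType) (A : eqType) {EA : Enc R A} : Prop :=
  polytime (fun p : A * A => p.1 == p.2).

(* Redefined below, as lemmas on further functions become available. *)
Ltac pt_user := fail.

Ltac pt_step := cbv beta; first
  [ assumption
  | lazymatch goal with
    | |- polytime (fun x => x) => exact: polytime_id
    | |- polytime (@fst _ _) => (refine (polytime_fst (f := fun x => x) _);
      exact: polytime_id)
    | |- polytime (@snd _ _) => (refine (polytime_snd (f := fun x => x) _);
      exact: polytime_id)
    | |- polytime (fun x => fst _) => apply: polytime_fst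
    | |- polytime (fun x => snd _) => apply: polytime_snd
    | |- polytime (fun x => (_, _)) => apply: polytime_pair
    | |- polytime (fun x => true) => apply: polytime_true
    | |- polytime (fun x => false) => apply: polytime_false
    | |- polytime (fun x => nil) => apply: polytime_nil
    | |- polytime (fun x => None) => apply: polytime_none
    | |- polytime (fun x => 0) => apply: polytime_zero
    | |- polytime (fun x => 0%R) => apply: polytime_zeror
    | |- polytime (fun x => 1) => apply: polytime_one
    | |- polytime (fun x => cons _ _) => apply: polytime_cons
    | |- polytime (fun x => Some _) => apply: polytime_some
    | |- polytime (fun x => andb _ _) => apply: polytime_and
    | |- polytime (fun x => orb _ _) => apply: polytime_or
    | |- polytime (fun x => negb _) => apply: polytime_not
    | |- polytime (fun x => addn _ _) => apply: polytime_addn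
    | |- polytime (fun x => leq _ _) => apply: polytime_leq
    | |- polytime (fun x => GRing.add _ _) => apply: polytime_addr
    | |- polytime (fun x => Order.le _ _) => apply: polytime_ler
    | |- polytime (fun x => GRing.natmul _ _) => apply: polytime_natr
    | |- polytime (fun x => S _) => apply: polytime_succ
    | |- polytime (fun x => if _ then _ else _) => apply: polytime_if
    end
  | pt_user ].

Ltac pt := repeat pt_step.

Section ListRules.
Variable R : realType.
Context G {EG : Enc R G}.

Section Rev.
Context A {EA : Enc R A}.

Lemma polytime_catrev (s t : G -> seq A) :
  polytime s -> polytime t -> polytime (fun x => catrev (s x) (t x)).
Proof.
move=> ps pt_; apply: (@polytime_ext _ _ _ _ _
  (fun x => foldl (fun acc a => a :: acc) (t x) (s x))).
  by move=> x; elim: (s x) (t x) => //= a l IH u; rewrite -IH.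
apply: (@polytime_foldl_add _ _ _ _ _ _ _ _ _ (fun _ acc a => a :: acc)
  ps pt_ _ (fun n => n + 1)) => [||x acc a]; first by pt.
- by poly_bound.
- by rewrite esize_cons; lia.
Qed.

Lemma polytime_rev (s : G -> seq A) : polytime s -> polytime (fun x => rev (s x)).
Proof. by move=> ps; apply: polytime_catrev ps _; apply: polytime_nil. Qed.

Lemma polytime_cat (s t : G -> seq A) :
  polytime s -> polytime t -> polytime (fun x => s x ++ t x).
Proof.
move=> ps pt_; apply: (@polytime_ext _ _ _ _ _
  (fun x => catrev (rev (s x)) (t x))); last first.
  exact: polytime_catrev (polytime_rev ps) pt_.
by move=> x; rewrite catrevE revK.
Qed.

End Rev.

Section MapFilter.
Context A {EA : Enc R A}.
Variable l : G -> seq A.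
Hypothesis pl : polytime l.

Lemma polytime_map B {EB : Enc R B} (f : G -> A -> B) :
  polytime (fun p : G * A => f p.1 p.2) ->
  polytime (fun x => [seq f x a | a <- l x]).
Proof.
move=> pf; apply: (@polytime_ext _ _ _ _ _
  (fun x => rev (foldl (fun acc a => f x a :: acc) [::] (l x)))).
  move=> x; rewrite -(revK (map _ _)); congr rev; rewrite -[RHS]cats0 /=.
  by rewrite -catrevE; elim: (l x) [::] => //=.
apply: polytime_rev; have [T [pT fT]] := polytime_size pf.
apply: (@polytime_foldl_add _ _ _ _ _ _ _ _ _ (fun x acc a => f x a :: acc)
  pl _ _ (fun n => T (n + 1) + 1)) => [|||x acc a].
- by pt.
- apply: polytime_cons; last by pt.
  apply: (polytime_comp (f := fun p : G * (seq B * A) => (p.1, p.2.2)) pf); pt.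
- by poly_bound.
- by move: (fT (x, a)); rewrite esize_cons esize_pair -[X in T X]addn1 /=; lia.
Qed.

Lemma polytime_filter (p : G -> A -> bool) :
  polytime (fun q : G * A => p q.1 q.2) ->
  polytime (fun x => [seq a <- l x | p x a]).
Proof.
move=> pp; apply: (@polytime_ext _ _ _ _ _
  (fun x => rev (foldl (fun acc a => if p x a then a :: acc else acc)
     [::] (l x)))).
  move=> x; rewrite -(revK (filter _ _)); congr rev; rewrite -[RHS]cats0 /=.
  rewrite -catrevE; elim: (l x) [::] => //= a s IH u.
  by rewrite IH; case: (p x a).
apply: polytime_rev.
apply: (@polytime_foldl_add _ _ _ _ _ _ _ _ _
  (fun x acc a => if p x a then a :: acc else acc)
  pl _ _ (fun n => n + 1)) => [|||x acc a].
- by pt.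
- apply: polytime_if; [|by pt|by pt].
  apply: (polytime_comp (f := fun p : G * (seq A * A) => (p.1, p.2.2)) pp); pt.
- by poly_bound.
- by case: (p x a); rewrite ?esize_cons; lia.
Qed.

Lemma polytime_count (p : G -> A -> bool) :
  polytime (fun q : G * A => p q.1 q.2) ->
  polytime (fun x => count (p x) (l x)).
Proof.
move=> pp; apply: (@polytime_ext _ _ _ _ _
  (fun x => foldl (fun n a => if p x a then n + 1 else n) 0 (l x))).
  move=> x; rewrite -[RHS]add0n; move: {2 3}0 => n.
  elim: (l x) n => /= [n|a s IH n]; first by rewrite addn0.
  by rewrite IH; case: (p x a); rewrite ?addnA ?addn0.
apply: (@polytime_foldl_const _ _ _ _ _ _ _ _ _
   (fun x n a => if p x a then n + 1 else n) pl _ _ 1) => [||//]; first by pt.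
apply: polytime_if; [|by pt|by pt].
apply: (polytime_comp (f := fun p : G * (nat * A) => (p.1, p.2.2)) pp); pt.
Qed.

Lemma polytime_seqsize : polytime (fun x => size (l x)).
Proof.
apply: (@polytime_ext _ _ _ _ _ (fun x => count (fun=> true) (l x))).
  by move=> x; rewrite count_predT.
by apply: polytime_count; apply: polytime_true.
Qed.

Lemma polytime_has (p : G -> A -> bool) :
  polytime (fun q : G * A => p q.1 q.2) ->
  polytime (fun x => has (p x) (l x)).
Proof.
move=> pp; apply: (@polytime_ext _ _ _ _ _ (fun x => 1 <= count (p x) (l x))).
  by move=> x; rewrite has_count.
by apply: polytime_leq; [pt | apply: polytime_count].
Qed.

Lemma polytime_all (p : G -> A -> bool) :
  polytime (fun q : G * A => p q.1 q.2) ->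
  polytime (fun x => all (p x) (l x)).
Proof.
move=> pp; apply: (@polytime_ext _ _ _ _ _
  (fun x => ~~ has (fun a => ~~ p x a) (l x))).
  by move=> x; rewrite -all_predC; apply: eq_all => a /=; rewrite negbK.
by apply: polytime_not; apply: polytime_has; apply: polytime_not.
Qed.

Lemma polytime_sum (f : G -> A -> R) :
  polytime (fun q : G * A => f q.1 q.2) ->
  polytime (fun x => foldl (fun r a => r + f x a)%R 0%R (l x)).
Proof.
move=> pf; apply: (@polytime_foldl_const _ _ _ _ _ _ _ _ (fun=> 0%R)
   (fun x r a => r + f x a)%R pl _ _ 1) => [||//].
  exact: polytime_zeror.
apply: polytime_addr; first by pt.
apply: (polytime_comp (f := fun p : G * (R * A) => (p.1, p.2.2)) pf); pt.
Qed.

Lemma polytime_zip B {EB : Enc R B} (s : G -> seq B) :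
  polytime s -> polytime (fun x => zip (l x) (s x)).
Proof.
move=> ps.
pose step (st : seq B * seq (A * B)) a :=
  if st.1 is b :: r then (r, (a, b) :: st.2) else st.
apply: (@polytime_ext _ _ _ _ _
  (fun x => rev (foldl step (s x, [::]) (l x)).2)).
  move=> x; rewrite -(revK (zip _ _)); congr rev; rewrite -[RHS]cats0 /=.
  rewrite -catrevE; elim: (l x) (s x) [::] => /= [[|b t] u //|a s' IH [|b t] u].
    by rewrite [step _ a]/step /= IH; case: (s').
  by rewrite [step _ a]/step /= IH.
apply: polytime_rev; apply: polytime_snd.
apply: (@polytime_foldl_add _ _ _ _ _ _ _ _ _ (fun=> step)
  pl _ _ (fun n => n + 1)) => [|||x [[|b r] u] a].
- by pt.
- rewrite /step; cbv beta.
  apply: (@polytime_match R (G * ((seq B * seq (A * B)) * A)) _ B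
    (seq B * seq (A * B)) _ _ (fun p => p.2.1.1) (fun p => p.2.1)
    (fun p b r => (r, (p.2.2, b) :: p.2.1.2))); by pt.
- by poly_bound.
- by rewrite leq_addr.
- by rewrite /step !esize_pair /= !esize_cons esize_pair /=; lia.
Qed.

End MapFilter.

End ListRules.

Section MoreListRules.
Variable R : realType.
Context G {EG : Enc R G}.

Lemma polytime_flatten A {EA : Enc R A} (l : G -> seq (seq A)) :
  polytime l -> polytime (fun x => flatten (l x)).
Proof.
move=> pl; apply: (@polytime_ext _ _ _ _ _
  (fun x => foldl (fun acc s => acc ++ s) [::] (l x))).
  move=> x; rewrite -[RHS]cat0s; elim: (l x) [::] => /= [u|a s IH u].
    by rewrite cats0.
  by rewrite IH catA.
apply: (@polytime_foldl_add _ _ _ _ _ _ _ _ _ (fun _ acc s => acc ++ s)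
  pl _ _ id) => [|||x acc a].
- by pt.
- by cbv beta; apply: polytime_cat; pt.
- by poly_bound.
- by have := esize_cat (EA := EA) acc a; lia.
Qed.

Lemma polytime_eq_op (A : eqType) {EA : Enc R A} (f g : G -> A) :
  polytime_eq (EA := EA) -> polytime f -> polytime g ->
  polytime (fun x => f x == g x).
Proof.
move=> pA pf pg; apply: (polytime_comp (f := fun x => (f x, g x)) pA).
exact: polytime_pair.
Qed.

Lemma polytime_mem (A : eqType) {EA : Enc R A} (f : G -> A) (s : G -> seq A) :
  polytime_eq (EA := EA) -> polytime f -> polytime s ->
  polytime (fun x => f x \in s x).
Proof.
move=> pA pf ps; apply: (@polytime_ext _ _ _ _ _
  (fun x => has (fun a => a == f x) (s x))).
  by move=> x; rewrite -has_pred1; apply: eq_has.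
apply: polytime_has => //.
apply: (polytime_comp (f := fun p : G * A => (p.2, f p.1)) pA).
apply: polytime_pair; first by pt.
by apply: (polytime_comp pf); pt.
Qed.

End MoreListRules.

Section Equality.
Variable R : realType.

Lemma polytime_eq_nat : @polytime_eq R nat _.
Proof. by apply: polytime_eqn; pt. Qed.

Lemma polytime_eq_bool : @polytime_eq R bool _.
Proof.
apply: (@polytime_ext _ _ _ _ _
  (fun p : bool * bool => if p.1 then p.2 else ~~ p.2)); last by pt.
by case=> [[] []].
Qed.

Lemma polytime_eq_pair (A B : eqType) {EA : Enc R A} {EB : Enc R B} :
  polytime_eq (EA := EA) -> polytime_eq (EA := EB) ->
  @polytime_eq R (A * B)%type _.
Proof.
move=> pA pB; apply: (@polytime_ext _ _ _ _ _
  (fun p : (A * B) * (A * B) => (p.1.1 == p.2.1) && (p.1.2 == p.2.2))).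
  by case=> [[a b] [c d]].
apply: polytime_and.
  apply: (polytime_eq_op (f := fun p => p.1.1) (g := fun p => p.2.1) pA); pt.
apply: (polytime_eq_op (f := fun p => p.1.2) (g := fun p => p.2.2) pB); pt.
Qed.

Lemma polytime_eq_seq (A : eqType) {EA : Enc R A} :
  polytime_eq (EA := EA) -> @polytime_eq R (seq A) _.
Proof.
move=> pA; apply: (@polytime_ext _ _ _ _ _
  (fun p : seq A * seq A => (size p.1 == size p.2) &&
     all (fun q => q.1 == q.2) (zip p.1 p.2))).
  case=> [s t] /=; elim: s t => [|x s IH] [|y t] //=.
  by rewrite eqseq_cons -IH eqSS andbCA.
apply: polytime_and.
  by apply: polytime_eqn; apply: polytime_seqsize; pt.
apply: polytime_all; first by apply: polytime_zip; pt.
apply: (polytime_eq_op (f := fun q => q.2.1) (g := fun q => q.2.2) pA); pt.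
Qed.

End Equality.

(** * The algorithm *)

Definition lookup (L : seq (nat * nat)) (u : nat) : nat :=
  foldl (fun a p => if p.1 == u then p.2 else a) 0 L.

Definition relabel (L : seq (nat * nat)) (a b : nat) : seq (nat * nat) :=
  [seq (p.1, if p.2 == a then b else p.2) | p <- L].

(* A state consists of the component labels of the vertices and of the forest
   edges that produced them. *)
Definition merge_edge (st : seq (nat * nat) * seq (nat * nat)) (e : nat * nat) :=
  if lookup st.1 e.1 == lookup st.1 e.2 then st
  else (relabel st.1 (lookup st.1 e.1) (lookup st.1 e.2), e :: st.2).

Definition merge_all (vs : seq nat) (s : seq (nat * nat)) :=
  foldl merge_edge ([seq (v, v) | v <- vs], [::]) s.

Definition load (trees : seq (seq (nat * nat))) (e : nat * nat) : nat :=
  count (fun T => e \in T) trees.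

(** A bucket sort. Edges whose load is not among [levels] get lost, so the levels must exceed every
    load. *)
Definition by_load (es : seq (nat * nat)) (levels : seq nat)
    (trees : seq (seq (nat * nat))) : seq (nat * nat) :=
  flatten [seq [seq e <- es | load trees e == l] | l <- levels].

(** Kruskal's algorithm with the loads as edge costs. *)
Definition greedy_tree (vs : seq nat) (es : seq (nat * nat)) (levels : seq nat)
    (trees : seq (seq (nat * nat))) : seq (nat * nat) :=
  (merge_all vs (by_load es levels trees)).2.

(** [levels] is also the clock: with one forest per level, a load is at most the number of earlier
    forests and never runs out of levels. *)
Definition greedy_trees (vs : seq nat) (es : seq (nat * nat))
    (levels : seq nat) : seq (seq (nat * nat)) :=
  foldl (fun trees _ => greedy_tree vs es levels trees :: trees) [::] levels.

(* Counts from [0] up to [size s - 1]: the programs have no other source of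
   unary numbers than the lengths of lists. *)
Definition iota_size (A : Type) (s : seq A) : seq nat :=
  foldl (fun acc _ => 0 :: [seq n.+1 | n <- acc]) [::] s.

Definition pairs (A B : Type) (s : seq A) (t : seq B) : seq (A * B) :=
  flatten [seq [seq (a, b) | b <- t] | a <- s].

Definition side_of (L : seq (nat * nat)) (a b x : nat) : bool :=
  (lookup L x == lookup L a) || (lookup L x == lookup L b).

Definition cut_of (es : seq (nat * nat)) (side : nat -> bool) : seq bool :=
  [seq side e.1 != side e.2 | e <- es].

Definition labels_without (vs : seq nat) (T : seq (nat * nat))
    (q : (nat * nat) * (nat * nat) * ((nat * nat) * (nat * nat))) :=
  (merge_all vs [seq e <- T |
     ~~ [|| e == q.1.1, e == q.1.2, e == q.2.1 | e == q.2.2]]).1.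

(** The side contains [ab.1], so only the complement needs a test for being nonempty. Taking
    [ab.1 = ab.2] gives the sides made of one component. *)
Definition candidate (vs : seq nat) (es : seq (nat * nat))
    (L : seq (nat * nat)) (ab : nat * nat) : seq (seq bool) :=
  if has (fun x => ~~ side_of L ab.1 ab.2 x) vs
  then [:: cut_of es (side_of L ab.1 ab.2)] else [::].

Definition candidates_from (vs : seq nat) (es : seq (nat * nat))
    (L : seq (nat * nat)) : seq (seq bool) :=
  flatten [seq candidate vs es L ab | ab <- pairs vs vs].

(* The dummy edge [(0, 0)] stands for removing fewer than four edges. *)
Definition candidates (vs : seq nat) (es : seq (nat * nat)) : seq (seq bool) :=
  let D := (0, 0) :: es in
  let levels := iota_size (pairs D D) in
  flatten [seq candidates_from vs es (labels_without vs Tq.1 Tq.2)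
          | Tq <- pairs (greedy_trees vs es levels)
                    (pairs (pairs D D) (pairs D D))].

Definition dedup (A : eqType) (s : seq A) : seq A :=
  foldl (fun acc x => if x \in acc then acc else x :: acc) [::] s.

Definition min_cuts (vs : seq nat) (es : seq (nat * nat)) : seq (seq bool) :=
  let M := candidates vs es in
  dedup [seq x <- M | all (fun y => count id x <= count id y) M].

Section Selection.
Variable R : realType.
Implicit Types (w : seq R) (x y : seq bool) (S : seq (seq bool)).

Local Open Scope ring_scope.

Definition cut_dist w x y : R :=
  foldl (fun r p => r + (if p.2.1 == p.2.2 then 0 else p.1)) 0
    (zip w (zip x y)).

(** The sum is over ordered pairs, which makes it twice [d_sum]. *)
Definition dispersion w S : R :=
  foldl (fun r p => r + cut_dist w p.1 p.2) 0 (pairs S S).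

Definition best w S (L : seq (seq (seq bool))) : seq (seq bool) :=
  foldl (fun S S' => if dispersion w S <= dispersion w S' then S' else S) S L.

Definition swap S x y : seq (seq bool) := y :: [seq z <- S | z != x].

Definition swaps (pts : seq (seq bool)) S : seq (seq (seq bool)) :=
  [seq swap S p.1 p.2 | p <- pairs S [seq y <- pts | y \notin S]].

(** The list [pairs S S] of the initial [S] is only a clock of k ^ 2 rounds. *)
Definition local_search w pts S : seq (seq bool) :=
  foldl (fun S' _ => best w S' (swaps pts S')) S (pairs S S).

Definition extend (pts : seq (seq bool)) (L : seq (seq (seq bool))) :
    seq (seq (seq bool)) :=
  flatten [seq [seq y :: X | y <- [seq y <- pts | y \notin X]] | X <- L].

(** [U] is a unary counter. Each set is listed in all its orders, a factor that is bounded when the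
    length of [U] is. *)
Definition subsets (A : Type) (pts : seq (seq bool)) (U : seq A) :=
  foldl (fun L _ => extend pts L) [:: [::]] U.

(** [k] comes as a single number, so a list of that length has to be cut out of [pts]. The returned
    count tells whether [pts] was long enough. *)
Definition first_points (pts : seq (seq bool)) (k : nat) :=
  foldl (fun (st : nat * seq (seq bool)) x =>
    if (st.1 < k)%N then (st.1.+1, x :: st.2) else st) (0%N, [::]) pts.

(** The first component is eps times the length of the second, obtained by additions only. Stopping
    at 12 keeps the length bounded in terms of eps. *)
Definition short_prefix (eps : R) (S : seq (seq bool)) : R * seq (seq bool) :=
  foldl (fun (st : R * seq (seq bool)) x =>
    if 12%:R <= st.1 then st else (st.1 + eps, x :: st.2)) (0, [::]) S.

Definition weighted_edges : Type := seq (seq nat * R).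

Definition edge_ends (e : seq nat) : nat * nat := (head 0%N e, head 0%N (behead e)).

Definition ends (wes : weighted_edges) : seq (nat * nat) :=
  [seq edge_ends e.1 | e <- wes].

Definition weights (wes : weighted_edges) : seq R := [seq e.2 | e <- wes].

Definition edges_of (wes : weighted_edges) x : seq (seq nat) :=
  [seq p.1.1 | p <- [seq p <- zip wes x | p.2]].

(* If [12 <= r], then [12 <= eps * k] and local search is accurate enough;
   otherwise the prefix [U] with [r = eps * size U] is all of [S], and [L] lists
   the selections of [k] points. *)
Definition select (wes : weighted_edges) (pts : seq (seq bool))
    (S : seq (seq bool)) (r : R) (L : seq (seq (seq bool))) :=
  best (weights wes) (local_search (weights wes) pts S)
    (if 12%:R <= r then [::] else L).

Definition prepare (I : R * (seq nat * (weighted_edges * nat))) :=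
  let pts := min_cuts I.2.1 (ends I.2.2.1) in
  let S := first_points pts I.2.2.2 in
  (I.2.2, (pts, (S, short_prefix I.1 S.2))).

Definition finish (p : (weighted_edges * nat) * (seq (seq bool) *
     ((nat * seq (seq bool)) * (R * seq (seq bool)))) * seq (seq (seq bool))) :=
  let: ((wes, k, (pts, (fk, r))), L) := p in
  if (k <= fk.1)%N then
    Some [seq edges_of wes x | x <- select wes pts fk.2 r.1 L]
  else None.

(** Separated from [prepare] and [finish], which are polynomial uniformly in eps. *)
Definition brute_force (p : (weighted_edges * nat) * (seq (seq bool) *
     ((nat * seq (seq bool)) * (R * seq (seq bool))))) :=
  (p, subsets p.2.1 p.2.2.2.2).

Definition diverse_cuts (I : R * (seq nat * (weighted_edges * nat))) :=
  finish (brute_force (prepare I)).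

End Selection.

Lemma foldl_iter A B (f : B -> B) (s : seq A) b :
  foldl (fun b _ => f b) b s = iter (size s) f b.
Proof. by elim: s b => //= x s IH b; rewrite IH -iterSr. Qed.

Lemma size_pairs A B (s : seq A) (t : seq B) :
  size (pairs s t) = size s * size t.
Proof.
by elim: s => //= a s IH;
  rewrite /pairs /= size_cat size_map -/(pairs s t) IH mulSn.
Qed.

(** * Running time of the algorithm *)

Section Specialized.
Variable R : realType.
Context G {EG : Enc R G}.

Lemma polytime_app2 A B C {EA : Enc R A} {EB : Enc R B} {EC : Enc R C}
    (h : A -> B -> C) (f : G -> A) (g : G -> B) :
  polytime (fun p : A * B => h p.1 p.2) -> polytime f -> polytime g ->
  polytime (fun x => h (f x) (g x)).
Proof.
move=> ph pf pg; apply: (polytime_comp (f := fun x => (f x, g x)) ph).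
exact: polytime_pair.
Qed.

Lemma polytime_app3 A B C D {EA : Enc R A} {EB : Enc R B} {EC : Enc R C}
    {ED : Enc R D} (h : A -> B -> C -> D)
    (f : G -> A) (g : G -> B) (k : G -> C) :
  polytime (fun p : A * B * C => h p.1.1 p.1.2 p.2) ->
  polytime f -> polytime g -> polytime k ->
  polytime (fun x => h (f x) (g x) (k x)).
Proof.
move=> ph pf pg pk; apply: (polytime_comp (f := fun x => (f x, g x, k x)) ph).
by apply: polytime_pair => //; apply: polytime_pair.
Qed.

Lemma polytime_eq_nat2 : @polytime_eq R (nat * nat)%type _.
Proof.
exact: (@polytime_eq_pair R nat nat _ _ (@polytime_eq_nat R) (@polytime_eq_nat R)).
Qed.

Lemma polytime_eq_mask : @polytime_eq R (seq bool) _.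
Proof. exact: (@polytime_eq_seq R bool _ (@polytime_eq_bool R)). Qed.

Lemma polytime_eq_edge (f g : G -> nat * nat) :
  polytime f -> polytime g -> polytime (fun x => f x == g x).
Proof. exact: (@polytime_eq_op R G EG (nat * nat)%type _ f g polytime_eq_nat2). Qed.

Lemma polytime_eq_boolop (f g : G -> bool) :
  polytime f -> polytime g -> polytime (fun x => f x == g x).
Proof. exact: (@polytime_eq_op R G EG bool _ f g (@polytime_eq_bool R)). Qed.

Lemma polytime_mem_edge (f : G -> nat * nat) (s : G -> seq (nat * nat)) :
  polytime f -> polytime s -> polytime (fun x => f x \in s x).
Proof. exact: (@polytime_mem R G EG (nat * nat)%type _ f s polytime_eq_nat2). Qed.

Lemma polytime_eq_cut (f g : G -> seq bool) :
  polytime f -> polytime g -> polytime (fun x => f x == g x).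
Proof. exact: (@polytime_eq_op R G EG (seq bool) _ f g polytime_eq_mask). Qed.

Lemma polytime_mem_cut (f : G -> seq bool) (s : G -> seq (seq bool)) :
  polytime f -> polytime s -> polytime (fun x => f x \in s x).
Proof. exact: (@polytime_mem R G EG (seq bool) _ f s polytime_eq_mask). Qed.

End Specialized.

Ltac pt_list := lazymatch goal with
  | |- polytime (fun x => flatten _) => apply: polytime_flatten
  | |- polytime (fun x => map _ _) => apply: polytime_map
  | |- polytime (fun x => filter _ _) => apply: polytime_filter
  | |- polytime (fun x => count _ _) => apply: polytime_count
  | |- polytime (fun x => has _ _) => apply: polytime_has
  | |- polytime (fun x => all _ _) => apply: polytime_all
  | |- polytime (fun x => zip _ _) => apply: polytime_zip
  | |- polytime (fun x => size _) => apply: polytime_seqsize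
  | |- polytime (fun x => cat _ _) => apply: polytime_cat
  | |- polytime (fun x => @in_mem ?T _ (mem _)) =>
      first [ unify T (nat * nat)%type; apply: polytime_mem_edge
            | unify T (seq bool); apply: polytime_mem_cut ]
  | |- polytime (fun x => @eq_op ?T _ _) =>
      first [ unify (Equality.sort T) nat; apply: polytime_eqn
            | unify (Equality.sort T) bool; apply: polytime_eq_boolop
            | unify (Equality.sort T) (nat * nat)%type; apply: polytime_eq_edge
            | unify (Equality.sort T) (seq bool); apply: polytime_eq_cut ]
  end.

Ltac pt_user ::= pt_list.

Section GraphPrograms.
Variable R : realType.

Lemma polytime_lookup :
  @polytime R _ _ _ _ (fun p : seq (nat * nat) * nat => lookup p.1 p.2).
Proof.
apply: (@polytime_foldl_const R (seq (nat * nat) * nat) _ _ _ _ _ fst (fun=> 0)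
  (fun x a p => if p.1 == x.2 then p.2 else a) _ _ _ 1); by [|pt].
Qed.

Lemma polytime_relabel :
  @polytime R _ _ _ _ (fun p : seq (nat * nat) * nat * nat =>
    relabel p.1.1 p.1.2 p.2).
Proof. by rewrite /relabel; pt. Qed.

Lemma polytime_merge :
  @polytime R _ _ _ _ (fun p : (seq (nat * nat) * seq (nat * nat)) * (nat * nat) =>
    merge_edge p.1 p.2).
Proof.
rewrite /merge_edge; pt; try (apply: (polytime_app2 polytime_lookup); pt).
apply: (polytime_app3 polytime_relabel); pt;
  try (apply: (polytime_app2 polytime_lookup); pt).
Qed.

(** Labels are numbers, each of one cell, so renaming them costs no space. *)
Lemma esize_relabel L a b : @esize R _ _ (relabel L a b) = @esize R _ _ L.
Proof. by elim: L => //= p L IH; rewrite !esize_cons IH. Qed.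

Lemma esize_merge_edge st e :
  @esize R _ _ (merge_edge st e) <= (@esize R _ _ st + @esize R _ _ e).+1.
Proof.
rewrite /merge_edge; case: ifP => _; first by rewrite -addnS leq_addr.
by rewrite !esize_pair /= esize_relabel esize_cons !esize_pair; lia.
Qed.

Lemma polytime_merge_all :
  @polytime R _ _ _ _ (fun p : seq nat * seq (nat * nat) => merge_all p.1 p.2).
Proof.
apply: (@polytime_foldl_add R (seq nat * seq (nat * nat)) _ _ _ _ _ snd
  (fun p => ([seq (v, v) | v <- p.1], [::])) (fun _ => merge_edge) _ _ _
  (fun n => n + 1)); try by pt.
- by apply: (polytime_app2 polytime_merge); pt.
- by poly_bound.
- by move=> x st e; move: (esize_merge_edge st e); lia.
Qed.

Lemma esize_merged_edges st s :
  @esize R _ _ (foldl merge_edge st s).2 <= @esize R _ _ st.2 + @esize R _ _ s.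
Proof.
elim: s st => [|e s IH] st /=; first by rewrite leq_addr.
apply: leq_trans (IH _) _; rewrite /merge_edge; case: ifP => _ /=.
  by rewrite leq_add2l esize_cons; lia.
by rewrite !esize_cons; lia.
Qed.

Lemma polytime_load :
  @polytime R _ _ _ _ (fun p : seq (seq (nat * nat)) * (nat * nat) =>
    load p.1 p.2).
Proof. by rewrite /load; pt. Qed.

Lemma polytime_by_load :
  @polytime R _ _ _ _ (fun p : seq (nat * nat) * seq nat * seq (seq (nat * nat)) =>
    by_load p.1.1 p.1.2 p.2).
Proof.
by rewrite /by_load; pt; apply: (polytime_app2 polytime_load); pt.
Qed.

Lemma esize_filter A {EA : Enc R A} (p : pred A) s : esize (filter p s) <= esize s.
Proof. by elim: s => //= x s IH; case: (p x); rewrite !esize_cons; lia. Qed.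

(** The bound does not mention [trees]; this is what makes the list of forests grow additively in
    [polytime_greedy_trees]. *)
Lemma esize_by_load es levels trees :
  @esize R _ _ (by_load es levels trees) <=
  @esize R _ _ levels * @esize R _ _ es.
Proof.
rewrite /by_load; elim: levels => [|l levels IH] /=.
  by rewrite mul1n esize_gt0.
set f := filter _ es; set t := flatten _ in IH *; rewrite esize_cons mulSn mulnDl.
pose proof (esize_cat (R := R) f t) as cat_ft.
pose proof (esize_filter (fun e => load trees e == l) es) as f_es.
rewrite -/f in f_es; lia.
Qed.

Lemma polytime_greedy_trees :
  @polytime R _ _ _ _ (fun p : seq nat * seq (nat * nat) * seq nat =>
    greedy_trees p.1.1 p.1.2 p.2).
Proof.
apply: (@polytime_foldl_add R (seq nat * seq (nat * nat) * seq nat) _ _ _ _ _ snd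
  (fun p => [::]) (fun p trees _ => greedy_tree p.1.1 p.1.2 p.2 trees :: trees)
  _ _ _ (fun n => n * n + 2)); try by pt.
- pt; rewrite /greedy_tree; pt.
  apply: (polytime_app2 polytime_merge_all); pt.
  by apply: (polytime_app3 polytime_by_load); pt.
- by poly_bound.
- move=> [[vs es] levels] trees l /=;
  rewrite esize_cons /greedy_tree !esize_pair /=.
  have := esize_merged_edges ([seq (v, v) | v <- vs], [::]) (by_load es levels trees).
  rewrite -/(merge_all _ _) /= [X in _ <= X + _]/esize /=.
  by move: (esize_by_load es levels trees); nia.
Qed.

Lemma esize_map_succ (s : seq nat) :
  @esize R _ _ [seq n.+1 | n <- s] = @esize R _ _ s.
Proof. by elim: s => //= n s IH; rewrite !esize_cons IH. Qed.

Lemma polytime_iota_size A {EA : Enc R A} :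
  @polytime R _ _ _ _ (fun s : seq A => iota_size s).
Proof.
apply: (@polytime_foldl_add R (seq A) _ _ _ _ _ (fun s => s)
  (fun=> [::]) (fun _ acc _ => 0 :: [seq n.+1 | n <- acc])
  _ _ _ (fun=> 2)); try by pt.
- by poly_bound.
- by move=> s acc a; rewrite esize_cons esize_map_succ [X in X + _]/esize /=; lia.
Qed.

Lemma polytime_pairs A B {EA : Enc R A} {EB : Enc R B} :
  @polytime R _ _ _ _ (fun p : seq A * seq B => pairs p.1 p.2).
Proof. by rewrite /pairs; pt. Qed.

Lemma polytime_side_of :
  @polytime R _ _ _ _ (fun p : seq (nat * nat) * (nat * nat) * nat =>
    side_of p.1.1 p.1.2.1 p.1.2.2 p.2).
Proof.
by rewrite /side_of; pt; apply: (polytime_app2 polytime_lookup); pt.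
Qed.

Lemma polytime_candidate :
  @polytime R _ _ _ _ (fun p : seq nat * seq (nat * nat) *
     (seq (nat * nat)) * (nat * nat) => candidate p.1.1.1 p.1.1.2 p.1.2 p.2).
Proof.
rewrite /candidate /cut_of; pt.
- by apply: (polytime_app3 (h := fun L ab x => side_of L ab.1 ab.2 x)
     polytime_side_of); pt.
- by apply: (polytime_app3 (h := fun L ab x => side_of L ab.1 ab.2 x)
     polytime_side_of); pt.
- by apply: (polytime_app3 (h := fun L ab x => side_of L ab.1 ab.2 x)
     polytime_side_of); pt.
Qed.

Lemma polytime_candidates_from :
  @polytime R _ _ _ _ (fun p : seq nat * seq (nat * nat) * seq (nat * nat) =>
     candidates_from p.1.1 p.1.2 p.2).
Proof.
rewrite /candidates_from; pt.
  by apply: (polytime_app2 (h := @pairs nat nat) (polytime_pairs (A :=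
    nat) (B := nat))); pt.
exact: polytime_candidate.
Qed.

End GraphPrograms.

Ltac pt_graph := lazymatch goal with
  | |- polytime (fun x => @pairs ?A ?B _ _) =>
      apply: (polytime_app2 (h := @pairs A B) (polytime_pairs (A := A) (B := B)))
  | |- polytime (fun x => lookup _ _) => apply: (polytime_app2 (@polytime_lookup _))
  | |- polytime (fun x => merge_all _ _) =>
      apply: (polytime_app2 (@polytime_merge_all _))
  | |- polytime (fun x => candidates_from _ _ _) =>
      apply: (polytime_app3 (@polytime_candidates_from _))
  | |- polytime (fun x => greedy_trees _ _ _) =>
      apply: (polytime_app3 (@polytime_greedy_trees _))
  | |- polytime (fun x => @iota_size ?A _) =>
      apply: (polytime_comp (g := @iota_size A) (polytime_iota_size (A := A)))
  | |- _ => pt_list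
  end.

Ltac pt_user ::= pt_graph.

Section Programs.
Variable R : realType.

Lemma polytime_candidates :
  @polytime R _ _ _ _ (fun p : seq nat * seq (nat * nat) => candidates p.1 p.2).
Proof. by rewrite /candidates /labels_without; cbv zeta; pt. Qed.

Lemma polytime_dedup_cut :
  @polytime R _ _ _ _ (fun s : seq (seq bool) => dedup s).
Proof.
apply: (@polytime_foldl_add R (seq (seq bool)) _ _ _ _ _ (fun s => s)
  (fun=> [::]) (fun _ acc x => if x \in acc then acc else x :: acc)
  _ _ _ (fun n => n + 1)); try by pt.
- by poly_bound.
- move=> s acc x; case: ifP => _; first exact: leq_addr.
  by rewrite esize_cons -addSn addnC leq_add2l -addn1 leq_add2r leq_addl.
Qed.

Lemma polytime_min_cuts :
  @polytime R _ _ _ _ (fun p : seq nat * seq (nat * nat) => min_cuts p.1 p.2).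
Proof.
rewrite /min_cuts; apply: (polytime_comp polytime_dedup_cut); pt.
  by apply: (polytime_app2 polytime_candidates); pt.
by apply: (polytime_app2 polytime_candidates); pt.
Qed.

Lemma polytime_cut_dist :
  polytime (fun p : seq R * seq bool * seq bool => cut_dist p.1.1 p.1.2 p.2).
Proof. by rewrite /cut_dist; apply: polytime_sum; pt. Qed.

Lemma polytime_dispersion :
  polytime (fun p : seq R * seq (seq bool) => dispersion p.1 p.2).
Proof.
rewrite /dispersion; apply: polytime_sum; pt.
by apply: (polytime_app3 polytime_cut_dist); pt.
Qed.

Lemma best_mem (w : seq R) S L : best w S L \in S :: L.
Proof.
rewrite /best; elim: L S => [|S' L IH] S /=; first by rewrite mem_head.
case: ifP => _; first by rewrite in_cons IH orbT.
by have := IH S; rewrite !in_cons => /orP[->//|->]; rewrite !orbT.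
Qed.

(** The accumulator never grows: it is the initial set or a member of the list, by [best_mem]. *)
Lemma polytime_best :
  polytime (fun p : seq R * seq (seq bool) * seq (seq (seq bool)) =>
    best p.1.1 p.1.2 p.2).
Proof.
apply: (@polytime_foldl R (seq R * seq (seq bool) * seq (seq (seq bool))) _
  _ _ _ _ snd (fun p => p.1.2)
  (fun p X X' => if (dispersion p.1.1 X <= dispersion p.1.1 X')%R then X' else X)
  _ _ _ id); try by pt.
- by pt; apply: (polytime_app2 polytime_dispersion); pt.
- by poly_bound.
- move=> [[w S] L] l1 l2 /= e; rewrite !esize_pair /=.
  rewrite -/(best w S l1); have := best_mem w S l1; rewrite in_cons.
  case/orP=> [/eqP->|h]; first by lia.
  have : best w S l1 \in L by rewrite e mem_cat h.
  move=> bL; apply: leq_trans (ltnW (esize_mem bL)) _.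
  exact: leq_trans (leq_addl _ _) (leqnSn _).
Qed.

Lemma polytime_swaps :
  polytime (R := R) (fun p : seq (seq bool) * seq (seq bool) => swaps p.1 p.2).
Proof. by rewrite /swaps /swap; pt. Qed.

Lemma esize_swap (S : seq (seq bool)) x y :
  @esize R _ _ (swap S x y) <= (@esize R _ _ y + @esize R _ _ S).+1.
Proof. by rewrite esize_cons ltnS leq_add2l; apply: esize_filter. Qed.

(** A round replaces the set by itself or by a swap, which adds at most one point of [pts]; the
    growth is additive. *)
Lemma polytime_local_search :
  polytime (fun p : seq R * seq (seq bool) * seq (seq bool) =>
    local_search p.1.1 p.1.2 p.2).
Proof.
apply: (@polytime_foldl_add R (seq R * seq (seq bool) * seq (seq bool)) _
  _ _ _ _ (fun p => pairs p.2 p.2) (fun p => p.2)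
  (fun p X _ => best p.1.1 X (swaps p.1.2 X)) _ _ _ (fun n => n + 1));
  try by pt.
- pt; apply: (polytime_app3 polytime_best); pt.
  by apply: (polytime_app2 polytime_swaps); pt.
- by poly_bound.
- move=> [[w pts] S] X a /=; rewrite !esize_pair /=.
  have := best_mem w X (swaps pts X); rewrite in_cons.
  case/orP=> [/eqP->|]; first by rewrite leq_addr.
  case/mapP=> -[x y] /flattenP[_ /mapP[x' _ ->]] /mapP[y' ym [_ ->]] -> /=.
  apply: leq_trans (esize_swap _ _ _) _.
  have ypts : y' \in pts by move: ym; rewrite mem_filter => /andP[].
  rewrite -addSn addnC leq_add2l; apply: leq_trans (esize_mem ypts) _.
  rewrite addn1 leqW // addSn leqW // (leq_trans _ (leq_addr _ _)) //.
  by rewrite addSn leqW // (leq_trans _ (leq_addr _ _)) // leq_addl.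
Qed.

Lemma polytime_extend :
  polytime (R := R) (fun p : seq (seq bool) * seq (seq (seq bool)) =>
    extend p.1 p.2).
Proof. by rewrite /extend; pt. Qed.

Lemma polytime_first_points :
  polytime (R := R) (fun p : seq (seq bool) * nat => first_points p.1 p.2).
Proof.
apply: (@polytime_foldl_add R (seq (seq bool) * nat) _ _ _ _ _ fst
  (fun=> (0, [::]))
  (fun p st x => if st.1 < p.2 then (st.1.+1, x :: st.2) else st)
  _ _ _ (fun n => n + 1)); try by pt.
- by poly_bound.
- move=> p [i S] x; case: ifP => _; first by rewrite !esize_pair /= esize_cons;
    rewrite [esize i]/esize [esize i.+1]/esize /=; lia.
  exact: leq_addr.
Qed.

Lemma polytime_short_prefix :
  polytime (fun p : R * seq (seq bool) => short_prefix p.1 p.2).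
Proof.
apply: (@polytime_foldl_add R (R * seq (seq bool)) _ _ _ _ _ snd
  (fun=> (0%R, [::]))
  (fun p st x => if (12%:R <= st.1)%R then st else ((st.1 + p.1)%R, x :: st.2))
  _ _ _ (fun n => n + 1)); try by pt.
- by poly_bound.
- move=> p [i S] x; case: ifP => _; first exact: leq_addr.
  by rewrite !esize_pair /= esize_cons;
    rewrite [esize i]/esize [X in X + (_ + _).+1]/esize /=; lia.
Qed.

Lemma polytime_ends :
  polytime (fun wes : seq (seq nat * R) => ends wes).
Proof.
rewrite /ends /edge_ends; pt.
- apply: (@polytime_match R _ _ nat nat _ _ _ (fun=> 0) (fun _ a _ => a)); pt.
- apply: (@polytime_match R _ _ nat nat _ _ _ (fun=> 0) (fun _ a _ => a)); pt.
  by apply: (@polytime_match R _ _ nat (seq nat) _ _ _ (fun=> [::])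
    (fun _ _ r => r)); pt.
Qed.

Lemma polytime_prepare :
  polytime (fun I : R * (seq nat * (seq (seq nat * R) * nat)) => prepare I).
Proof.
rewrite /prepare; cbv zeta.
have pm : polytime (fun I : R * (seq nat * (seq (seq nat * R) * nat)) =>
    min_cuts I.2.1 (ends I.2.2.1)).
  apply: (polytime_app2 polytime_min_cuts); pt.
  by apply: (polytime_comp polytime_ends); pt.
have pf : polytime (fun I : R * (seq nat * (seq (seq nat * R) * nat)) =>
    first_points (min_cuts I.2.1 (ends I.2.2.1)) I.2.2.2).
  by apply: (polytime_app2 polytime_first_points) pm _; pt.
pt.
by apply: (polytime_app2 polytime_short_prefix); pt.
Qed.

Lemma polytime_finish :
  polytime (fun p : (seq (seq nat * R) * nat) * (seq (seq bool) *
     ((nat * seq (seq bool)) * (R * seq (seq bool)))) * seq (seq (seq bool)) =>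
    finish p).
Proof.
(* The closure rules know projections but no destructuring [let]. *)
pose finish' (p : (seq (seq nat * R) * nat) * (seq (seq bool) *
     ((nat * seq (seq bool)) * (R * seq (seq bool)))) * seq (seq (seq bool))) :=
  if p.1.1.2 <= p.1.2.2.1.1 then
    Some [seq edges_of p.1.1.1 x | x <-
      select p.1.1.1 p.1.2.1 p.1.2.2.1.2 p.1.2.2.2.1 p.2] else None.
apply: (@polytime_ext _ _ _ _ _ finish'); first by case=> [[[? ?] [? [? ?]]] ?].
rewrite /finish' /edges_of /select /weights; pt.
apply: (polytime_app3 polytime_best); pt.
by apply: (polytime_app3 polytime_local_search); pt.
Qed.

End Programs.

(** * Assembling the program: one text, a polynomial for each search depth *)

Section Assembly.
Variable R : realType.

(* Iterating a polynomial-time step is polynomial-time for each fixed number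
   [l] of iterations, with a polynomial depending on [l]. *)
Lemma implements_iterate A B C {EA : Enc R A} {EB : Enc R B} {EC : Enc R C}
    (l : A -> seq C) (i : A -> B) (step : A -> B -> B) :
  polytime l -> polytime i -> polytime (fun p : A * B => step p.1 p.2) ->
  exists c (T : nat -> nat -> nat), (forall n, poly_bound (T n)) /\
    implements c (fun a => foldl (fun b _ => step a b) (i a) (l a))
      (fun a => T (size (l a)) (esize a)).
Proof.
move=> pl pi pstep; have [Sl [pSl lS]] := polytime_size pl.
have [Si [pSi iS]] := polytime_size pi.
have [Ss [pSs sS]] := polytime_size pstep.
have pstep' : polytime (fun p : A * (B * C) => step p.1 p.2.1).
  by apply: (polytime_app2 pstep); pt.
have [cl [U [pU Il]]] := polytime_implements pl.
have [c0 [S [pS Ii]]] := polytime_implements pi.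
have [c [T [pT Is]]] := polytime_implements pstep'.
(* [b k n] bounds the state after [k] rounds. It composes [Ss] with itself, so its degree may grow
   with [k]. *)
pose b := fix b k n {struct k} :=
  if k is k'.+1 then b k' n + Ss (n + b k' n + 1) else Si n.
have pb k : poly_bound (b k) by elim: k => //= k IH; poly_bound.
have bmono k m n : k <= m -> b k n <= b m n.
  move=> /subnKC <-; elim: (m - k) => [|d IH]; first by rewrite addn0.
  by rewrite addnS /=; apply: leq_trans IH (leq_addr _ _).
have bS a (u : seq C) :
    esize (foldl (fun b _ => step a b) (i a) u) <= b (size u) (esize a).
  elim/last_ind: u => [|u x IH] //=; rewrite -cats1 foldl_cat size_cat addn1 /=.
  apply: leq_trans (sS (a, _)) _; apply: leq_trans (leq_addl _ _).
  by apply: pSs.2; rewrite esize_pair /= addn1 ltnS leq_add2l.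
pose M k n := T (n + b k n + Sl n + 2).
exists (fold_prog c0 cl c),
  (fun k n => S n + U n + Sl n * (M k n + 16) + b k n + 8).
split; first by move=> k; have := pb k; rewrite /M => pbk; poly_bound.
apply: implements_weaken (implements_foldl
  (M := fun a => M (size (l a)) (esize a)) Is Ii Il _) => // [a|a l1 x l2 e].
  rewrite leq_add2r leq_add //= leq_add2l leq_mul2r.
  by rewrite lS orbT.
apply: pT.2; rewrite !esize_pair /=.
have h1 : esize x <= Sl (esize a).
  by apply: leq_trans (lS a); rewrite e ltnW // esize_mid.
have h2 : esize (foldl (fun b _ => step a b) (i a) l1) <=
    b (size (l a)) (esize a).
  by apply: leq_trans (bS a l1) (bmono _ _ _ _); rewrite e size_cat leq_addr.
by rewrite addn2 ltnS addnS ltnS addnA leq_add // leq_add2l.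
Qed.

(** The order of quantifiers is that of [admits_PTAS]: the program is chosen first, and [K], which
    will be a function of eps, influences only the polynomial. *)
Lemma diverse_cuts_program : exists c, forall K, exists2 T, poly_bound T &
  forall I : R * (seq nat * (seq (seq nat * R) * nat)),
  size (prepare I).2.2.2.2 <= K ->
  exists t output, [/\ runs c (enc I) t output,
    output = enc (diverse_cuts I) & t <= T (esize I)].
Proof.
have [c1 [T1 [p1 I1]]] := polytime_implements (polytime_prepare R).
have [c3 [T3 [p3 I3]]] := polytime_implements (polytime_finish R).
have [Sp [pSp hSp]] := polytime_size (polytime_prepare R).
pose state : Type := ((seq (seq nat * R) * nat) * (seq (seq bool) *
     ((nat * seq (seq bool)) * (R * seq (seq bool)))))%type.
have [c [T [pT IT]]] := @implements_iterate state _ _ _ _ _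
  (fun p => p.2.2.2.2) (fun=> [:: [::]]) (fun p L => extend p.2.1 L)
  ltac:(by pt) ltac:(by pt) ltac:(by apply: (polytime_app2 (@polytime_extend R)); pt).
have [c0 [T0 [p0 I0]]] := polytime_implements (@polytime_id R state _).
have Ib := implements_pair I0 IT.
exists (comp_prog (comp_prog c1 (pair_prog c0 c)) c3 0) => K.
have [B [pB hB]] : exists B, poly_bound B /\
    forall n k, k <= K -> T0 n + T k n + 9 <= B n.
  (* [T] need not be monotone in the number of rounds; a sum over all depths up to [K] dominates
     each of them. *)
  have pS k : poly_bound (fun n => \sum_(i < k) T i n).
    elim: k => [|k [[d hd] hm]].
      split; first by exists 0 => n; rewrite big_ord0.
      by move=> m n _; rewrite !big_ord0.
    have [[e he] hk] := poly_bound_add (conj (ex_intro _ d hd) hm) (pT k).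
    split; first by exists e => n; rewrite big_ord_recr.
    by move=> m n mn; rewrite !big_ord_recr /=; apply: hk.
  exists (fun n => T0 n + \sum_(k < K.+1) T k n + 9).
  split; first by have := pS K.+1 => pSK; poly_bound.
  move=> n k kK; rewrite leq_add2r leq_add2l -ltnS in kK *.
  by rewrite (bigD1 (Ordinal kK)) //= leq_addr.
exists (fun n => T1 n + B (Sp n) + T3 (B (Sp n))); first by poly_bound.
move=> I IK.
have [t [s [E sb _ L]]] := implements_comp (implements_comp I1 Ib) I3
  (update_same (fun=> DNil) 0 (enc I)).
exists t, (enc (diverse_cuts I)); split=> //; first by exists s.
have hb : T0 (esize (prepare I)) + T (size (prepare I).2.2.2.2) (esize (prepare I))
    + 9 <= B (Sp (esize I)) by apply: leq_trans (hB _ _ IK) (pB.2 _ _ _).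
have hs : esize (brute_force (prepare I)) <= B (Sp (esize I)).
  have [t' [s' [_ _ _ L']]] := Ib 0 (fun=> enc (prepare I)) (prepare I) erefl.
  by apply: leq_trans hb; apply: leq_trans L'; rewrite leq_addl.
apply: leq_trans (leq_addr _ _) _; apply: leq_trans L _.
by rewrite leq_add ?leq_add //; apply: p3.2.
Qed.

End Assembly.

(** * Merging components *)

Section Lookup.

Definition lookup_from (c : nat) (L : seq (nat * nat)) (u : nat) : nat :=
  foldl (fun a p => if p.1 == u then p.2 else a) c L.

Lemma lookup_diag vs u : u \in vs -> lookup [seq (v, v) | v <- vs] u = u.
Proof.
rewrite /lookup -/(lookup_from 0 _ u); have: u \in vs -> u \in vs by [].
suff h c : lookup_from c [seq (v, v) | v <- vs] u = if u \in vs then u else c.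
  by rewrite h => _ ->.
elim: vs c => //= v vs IH c; rewrite IH in_cons [u == v]eq_sym.
by case: eqP => [->|]; case: (_ \in _).
Qed.

(** The default 0 of [lookup] is not renamed by [relabel], hence the hypothesis: from the first
    entry of [u] on, the two lookups correspond. *)
Lemma lookup_relabel L a b u : u \in [seq p.1 | p <- L] ->
  lookup (relabel L a b) u = if lookup L u == a then b else lookup L u.
Proof.
pose s x := if x == a then b else x; rewrite -/(s _) /lookup.
rewrite -!/(lookup_from 0 _ u); move: {1}0 => c'; move: 0 => c.
have same d : lookup_from (s d) (relabel L a b) u = s (lookup_from d L u).
  by elim: (L) d => //= p {}L IH d; rewrite -IH; case: eqP.
elim: L c c' same => //= p L IH c c' same; rewrite in_cons.
case: (eqVneq p.1 u) => [pu _|pu /= uL].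
  by have := same c; rewrite /= pu eqxx.
apply: IH => // d.
by have := same d; rewrite /= (negbTE pu).
Qed.

End Lookup.

Section Merging.
Variable vs : seq nat.

Definition inside (e : nat * nat) := (e.1 \in vs) && (e.2 \in vs).

Definition labelling (st : seq (nat * nat) * seq (nat * nat)) :=
  [seq p.1 | p <- st.1] = vs.

Definition label (st : seq (nat * nat) * seq (nat * nat)) := lookup st.1.

Definition num_labels st := size (undup [seq label st x | x <- vs]).

Lemma labelling_diag : labelling ([seq (v, v) | v <- vs], [::]).
Proof. by rewrite /labelling -map_comp map_id. Qed.

Lemma labelling_merge st e : labelling st -> labelling (merge_edge st e).
Proof.
rewrite /labelling /merge_edge; case: ifP => // _ <-.
by rewrite /= -map_comp.
Qed.

Lemma label_merge st e x : labelling st -> inside e -> x \in vs ->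
  label (merge_edge st e) x =
    if label st x == label st e.1 then label st e.2 else label st x.
Proof.
move=> st_vs /andP[e1 e2] xvs; rewrite /label /merge_edge.
case: eqP => [->|ne] /=; first by case: eqP.
by rewrite lookup_relabel ?st_vs.
Qed.

Section Run.
Variables (st : seq (nat * nat) * seq (nat * nat)) (s : seq (nat * nat)).
Hypotheses (st_vs : labelling st) (s_vs : {in s, forall e, inside e}).

Lemma labelling_run : labelling (foldl merge_edge st s).
Proof.
elim: s st st_vs => //= e s' IH st' st'_vs; apply: IH.
exact: labelling_merge.
Qed.

Lemma label_run_coarsens x y : x \in vs -> y \in vs ->
  label st x = label st y ->
  label (foldl merge_edge st s) x = label (foldl merge_edge st s) y.
Proof.
move=> xvs yvs; elim: s st st_vs s_vs => //= e s' IH st' st'_vs s'_vs xy.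
apply: IH; first exact: labelling_merge.
  by move=> f fs; apply: s'_vs; rewrite in_cons fs orbT.
by rewrite !label_merge ?xy // s'_vs ?mem_head.
Qed.

End Run.

Lemma label_run_closed st s e : labelling st -> {in s, forall e, inside e} ->
  e \in s -> label (foldl merge_edge st s) e.1 =
             label (foldl merge_edge st s) e.2.
Proof.
move=> st_vs s_vs es; have [s1 [s2 def_s]] : exists s1 s2, s = s1 ++ e :: s2.
  exists (take (index e s) s), (drop (index e s).+1 s).
  by rewrite -drop_index // cat_take_drop.
have s12 : forall f, f \in s1 \/ f \in e :: s2 -> inside f.
  by move=> f [] fs; apply: s_vs; rewrite def_s mem_cat fs ?orbT.
rewrite def_s foldl_cat /=.
have v1 : labelling (foldl merge_edge st s1).
  exact: labelling_run.
have ie : inside e by apply: s12; right; rewrite mem_head.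
have /andP[e1 e2] := ie.
apply: label_run_coarsens => //; first exact: labelling_merge.
  by move=> f fs; apply: s12; right; rewrite in_cons fs orbT.
by rewrite !label_merge // eqxx; case: eqP.
Qed.

(** The list of forest edges is a mere log that no decision consults, so a run can be cut in two and
    restarted with an empty log. *)
Lemma tree_run st s :
  (foldl merge_edge st s).2 = (foldl merge_edge (st.1, [::]) s).2 ++ st.2.
Proof.
elim: s st => [|e s IH] [L T] //=; rewrite /merge_edge /=.
case: ifP => _; first exact: IH.
by rewrite IH /= [in RHS]IH /= -catA.
Qed.

Lemma tree_run_sub L s : {subset (foldl merge_edge (L, [::]) s).2 <= s}.
Proof.
elim: s L => [|e s IH] L f //=; rewrite tree_run mem_cat in_cons.
rewrite /merge_edge /=; case: ifP => _ /= /orP[/IH->|]; rewrite ?orbT //.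
by rewrite mem_seq1 => ->.
Qed.

(** The final classes are generated by the initial ones and the forest edges alone: the edges that
    were skipped joined vertices already in one class. *)
Lemma label_run_finest st s (A : nat -> bool) :
  labelling st -> {in s, forall e, inside e} ->
  {in vs &, forall x y, label st x = label st y -> A x = A y} ->
  {in (foldl merge_edge st s).2, forall e, A e.1 = A e.2} ->
  {in vs &, forall x y,
     label (foldl merge_edge st s) x = label (foldl merge_edge st s) y ->
     A x = A y}.
Proof.
elim: s st => [|e s IH] st //= st_vs s_vs Ast AT.
have ie : inside e by rewrite s_vs ?mem_head.
have /andP[e1 e2] := ie.
apply: IH => //; first exact: labelling_merge.
  by move=> f fs; apply: s_vs; rewrite in_cons fs orbT.
have [Le|ne] := eqVneq (label st e.1) (label st e.2).
  by rewrite /merge_edge /label -!/(label st _) Le eqxx.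
have Ae : A e.1 = A e.2.
  apply: AT; rewrite tree_run mem_cat; apply/orP; right.
  by rewrite /merge_edge -!/(label st _) (negbTE ne) mem_head.
move=> x y xvs yvs; rewrite !label_merge //.
case: eqP => [xe|_]; case: eqP => [ye|_] h; last exact: Ast.
- by rewrite (Ast _ _ xvs e1 xe) (Ast _ _ yvs e1 ye).
- by rewrite (Ast _ _ xvs e1 xe) Ae; apply: Ast.
- by rewrite (Ast _ _ yvs e1 ye) Ae; apply: Ast.
Qed.

(** The only label that can disappear is that of [e.1]. *)
Lemma num_labels_merge st e : labelling st -> inside e ->
  num_labels st <= (num_labels (merge_edge st e)).+1.
Proof.
move=> st_vs ie; rewrite /num_labels.
rewrite -[X in _ <= X]/(size (label st e.1 ::
  undup [seq label (merge_edge st e) x | x <- vs])).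
apply: uniq_leq_size; first exact: undup_uniq.
move=> l; rewrite in_cons !mem_undup => /mapP[x xvs ->].
case: eqVneq => //= ne; apply/mapP; exists x => //.
by rewrite label_merge // (negbTE ne).
Qed.

(** Every edge entering the forest is paid for by the label of [e.1], which vanishes. *)
Lemma num_labels_merge_tree st e : labelling st -> inside e ->
  num_labels (merge_edge st e) + size (merge_edge st e).2 <=
  num_labels st + size st.2.
Proof.
move=> st_vs ie; have /andP[e1 e2] := ie.
have [Le|ne] := eqVneq (label st e.1) (label st e.2).
  by rewrite /merge_edge -!/(label st _) Le eqxx.
have -> : (merge_edge st e).2 = e :: st.2.
  by rewrite /merge_edge -!/(label st _) (negbTE ne).
rewrite /= addnS -addSn leq_add2r /num_labels.
rewrite -[X in X <= _]/(size (label st e.1 ::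
  undup [seq label (merge_edge st e) x | x <- vs])).
apply: uniq_leq_size => /=.
  rewrite undup_uniq andbT mem_undup; apply/mapP => -[x xvs].
  by rewrite label_merge //; case: eqP => [_ h|ne' h];
    [move: ne; rewrite h eqxx | case: ne'].
move=> l; rewrite in_cons !mem_undup => /orP[/eqP->|/mapP[x xvs ->]].
  exact: map_f.
by rewrite label_merge //; case: ifP => _; apply: map_f.
Qed.

Lemma num_labels_run st s : labelling st -> {in s, forall e, inside e} ->
  num_labels st <= num_labels (foldl merge_edge st s) + size s.
Proof.
elim: s st => [|e s IH] st st_vs s_vs /=; first by rewrite addn0.
have ie : inside e by rewrite s_vs ?mem_head.
apply: leq_trans (num_labels_merge st_vs ie) _; rewrite addnS ltnS.
apply: IH; first exact: labelling_merge.
by move=> f fs; apply: s_vs; rewrite in_cons fs orbT.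
Qed.

Lemma num_labels_run_tree st s : labelling st -> {in s, forall e, inside e} ->
  num_labels (foldl merge_edge st s) + size (foldl merge_edge st s).2 <=
  num_labels st + size st.2.
Proof.
elim: s st => [|e s IH] st st_vs s_vs //=.
have ie : inside e by rewrite s_vs ?mem_head.
apply: leq_trans (num_labels_merge_tree st_vs ie).
apply: IH; first exact: labelling_merge.
by move=> f fs; apply: s_vs; rewrite in_cons fs orbT.
Qed.

End Merging.

(** * Enumeration of the minimum cuts *)

Lemma count_sum (T : Type) (p : pred T) (s : seq T) :
  count p s = \sum_(x <- s) p x.
Proof. by elim: s => [|x s IH]; rewrite ?big_nil ?big_cons //= IH. Qed.

Lemma sum_pred1_le (T : eqType) (s : seq T) x :
  uniq s -> \sum_(y <- s) (x == y) <= 1.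
Proof.
move=> s_uniq; have -> : \sum_(y <- s) (x == y) = count_mem x s.
  by rewrite count_sum; apply: eq_bigr => y _; rewrite /= eq_sym.
by rewrite count_uniq_mem // leq_b1.
Qed.

Lemma count_sub_in (T : eqType) (a b : pred T) (s : seq T) :
  {in s, forall x, a x -> b x} -> count a s <= count b s.
Proof.
elim: s => //= x s IH ab; rewrite leq_add ?IH //.
  by have := ab x (mem_head _ _); case: (a x) => //= ->.
by move=> y ys; apply: ab; rewrite in_cons ys orbT.
Qed.

Section Cuts.
Variables (vs : seq nat) (es : seq (nat * nat)).

Definition cut_size (A : nat -> bool) := count (fun e => A e.1 != A e.2) es.

Definition nontrivial (A : nat -> bool) := has A vs && has (predC A) vs.

Definition minimal (A : nat -> bool) :=
  nontrivial A /\ forall B, nontrivial B -> cut_size A <= cut_size B.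

Variable lam : nat.
Hypothesis lam_le : forall A, nontrivial A -> lam <= cut_size A.

(** If [f] has at least two classes, each class is a side of a cut with at least [lam] edges, and an
    edge between classes lies in two of these cuts. The predecessor covers the case of a single
    class, which gives no cut, and it matches the number of edges of a spanning tree on the
    classes. *)
Lemma crossing_edges_ge (f : nat -> nat) :
  lam * (size (undup [seq f x | x <- vs])).-1 <=
  2 * count (fun e => f e.1 != f e.2) es.
Proof.
set ls := undup _; have [|ls_gt1] := leqP (size ls) 1.
  by case: (size ls) => [|[|]] //; rewrite muln0.
apply: (@leq_trans (lam * size ls)); first by rewrite leq_mul2l leq_pred orbT.
have class_nontrivial l : l \in ls -> nontrivial (fun x => f x == l).
  rewrite mem_undup => /mapP[x xvs ->]; apply/andP; split.
    by apply/hasP; exists x.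
  apply/hasPn => same; move: ls_gt1; rewrite ltnNge => /negP; apply.
  rewrite -[1]/(size [:: f x]); apply: uniq_leq_size; first exact: undup_uniq.
  move=> m; rewrite mem_undup mem_seq1 => /mapP[y yvs ->].
  by have := same y yvs; rewrite /= negbK.
apply: (@leq_trans (\sum_(l <- ls) cut_size (fun x => f x == l))).
  rewrite mulnC -sum1_size big_distrl /= big_seq [X in _ <= X]big_seq.
  by apply: leq_sum => l lls; rewrite mul1n; apply/lam_le/class_nontrivial.
under eq_bigr do rewrite /cut_size count_sum.
rewrite exchange_big /= count_sum big_distrr /=; apply: leq_sum => e _.
have [->|_] := eqVneq (f e.1) (f e.2).
  by rewrite big1 // => l _; rewrite eqxx.
apply: (@leq_trans (\sum_(l <- ls) ((f e.1 == l) + (f e.2 == l)))).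
  by apply: leq_sum => l _; case: (f e.1 == l); case: (f e.2 == l).
rewrite big_split muln1 -[2]/(1 + 1).
by rewrite leq_add ?sum_pred1_le ?undup_uniq.
Qed.

End Cuts.

(** * Numerical inequalities for the potential *)

Section Inequality.

(* [(1 + 2/n)^j (1 - j/2n)^4 <= 1] by induction on [j]; at [j = n] it bounds
   [(1 + 2/n)^n] by [16]. *)
Lemma expn_bound n : (n + 2) ^ n <= 16 * n ^ n.
Proof.
case: n => // n'; set n := n'.+1.
have n_gt0 : 0 < n by [].
suff h j : j <= n -> (n + 2) ^ j * (2 * n - j) ^ 4 <= (2 * n) ^ 4 * n ^ j.
  have := h n (leqnn n); rewrite (_ : 2 * n - n = n); last by lia.
  by rewrite expnMn -mulnA [n ^ 4 * _]mulnC mulnA leq_pmul2r ?expn_gt0.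
elim: j => [|j IH] jn; first by rewrite !expn0 subn0 mul1n muln1.
have {IH} := IH (ltnW jn).
set a := 2 * n - j; have -> : 2 * n - j.+1 = a.-1 by rewrite subnS.
have a_gt0 : 0 < a by rewrite /a; lia.
have a_le : a <= 2 * n by rewrite /a leq_subr.
move=> IH; rewrite -(leq_pmul2r (_ : 0 < a ^ 4)) ?expn_gt0 ?a_gt0 //.
apply: (@leq_trans ((2 * n) ^ 4 * n ^ j * ((n + 2) * a.-1 ^ 4))).
  have -> : (n + 2) ^ j.+1 * a.-1 ^ 4 * a ^ 4 =
      ((n + 2) ^ j * a ^ 4) * ((n + 2) * a.-1 ^ 4) by rewrite expnS; ring.
  by rewrite leq_mul2r IH orbT.
have -> : (2 * n) ^ 4 * n ^ j.+1 * a ^ 4 = (2 * n) ^ 4 * n ^ j * (n * a ^ 4).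
  by rewrite [n ^ j.+1]expnS; ring.
rewrite leq_mul2l; apply/orP; right.
have N_gt0 : 0 < (2 * n) ^ 4 by rewrite expn_gt0 muln_gt0.
rewrite -(leq_pmul2r N_gt0).
(* Since a <= 2n, the factor (1 - 1/a) ^ 4 is largest at a = 2n, that is, at j = 0; [h4] settles
   this worst case. *)
have ha : a.-1 * (2 * n) <= (2 * n).-1 * a by nia.
have h4 : (n + 2) * (2 * n).-1 ^ 4 <= n * (2 * n) ^ 4.
  have [k nk] : exists k, n = k.+1 by exists n'.
  by rewrite nk (_ : (2 * k.+1).-1 = 2 * k + 1); [rewrite !expnS expn0; nia|lia].
apply: (@leq_trans ((n + 2) * (2 * n).-1 ^ 4 * a ^ 4)).
  rewrite -[X in X <= _]mulnA -[X in _ <= X]mulnA leq_mul //.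
  by rewrite -[X in X <= _]expnMn -[X in _ <= X]expnMn leq_expn2r.
have -> : n * a ^ 4 * (2 * n) ^ 4 = n * (2 * n) ^ 4 * a ^ 4 by ring.
by rewrite leq_mul2r h4 orbT.
Qed.

(** Writes 2 ^ l as a sum of increments over the thresholds 0, ..., l, so that bounds on the number
    of edges above each threshold add up to a bound on the potential. *)
Lemma sum_doubling l :
  \sum_(i < l.+1) (if (i : nat) is j.+1 then 2 ^ j else 1) = 2 ^ l.
Proof.
elim: l => [|l IH]; first by rewrite big_ord_recl big_ord0.
by rewrite big_ord_recr IH /= addnn -mul2n expnS.
Qed.

End Inequality.

(** * Packing spanning forests by load *)

Section Packing.
Variables (vs : seq nat) (es : seq (nat * nat)).
Hypothesis es_vs : {in es, forall e, inside vs e}.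
Hypothesis es_uniq : uniq es.
Variables (lam M : nat).
Hypothesis lam_le : forall A, nontrivial vs A -> lam <= cut_size es A.

Notation tree := (greedy_tree vs es (iota 0 M)).

Lemma mem_by_load levels trees e :
  (e \in by_load es levels trees) = (e \in es) && (load trees e \in levels).
Proof.
apply/flattenP/andP => [[_ /mapP[l ll ->]]|[ees ll]].
  by rewrite mem_filter => /andP[/eqP-> ->].
exists [seq f <- es | load trees f == load trees e].
  by apply/mapP; exists (load trees e).
by rewrite mem_filter eqxx.
Qed.

Lemma by_load_vs levels trees : {in by_load es levels trees, forall e, inside vs e}.
Proof. by move=> e; rewrite mem_by_load => /andP[/es_vs]. Qed.

Lemma greedy_tree_sub trees : {subset tree trees <= es}.
Proof.
by move=> e /tree_run_sub; rewrite mem_by_load => /andP[].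
Qed.

(* The edges of load at least [i] in the tree are fewer than the components
   spanned by the edges of smaller load, and each of these components has at
   least [lam] edges of load at least [i] leaving it. *)
Lemma tree_edges_above trees i : (forall e, e \in es -> load trees e < M) ->
  lam * count (fun e => (e \in tree trees) && (i <= load trees e)) es <=
  2 * count (fun e => i <= load trees e) es.
Proof.
move=> loads; have [iM|Mi] := leqP i M; last first.
  suff -> : count (fun e => (e \in tree trees) && (i <= load trees e)) es = 0.
    by rewrite muln0.
  apply/eqP; rewrite eqn0Ngt -has_count; apply/hasPn => e ees.
  by rewrite negb_and -ltnNge (leq_trans (loads e ees)) ?orbT // ltnW.
have def_s : by_load es (iota 0 M) trees =
    by_load es (iota 0 i) trees ++ by_load es (iota i (M - i)) trees.
  rewrite /by_load -flatten_cat -map_cat -{2}[i]add0n -iotaD subnKC //.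
set st0 := ([seq (v, v) | v <- vs], [::] : seq (nat * nat)).
set st := foldl merge_edge st0 (by_load es (iota 0 i) trees).
have st0_vs : labelling vs st0 by apply: labelling_diag.
have st_vs : labelling vs st by apply: labelling_run.
set new := (foldl merge_edge (st.1, [::]) (by_load es (iota i (M - i)) trees)).2.
have def_T : tree trees = new ++ st.2.
  by rewrite /greedy_tree /merge_all def_s foldl_cat tree_run.
have small_new : size new <= (num_labels vs st).-1.
  case vs0: (vs == [::]).
    suff -> : new = [::] by [].
    apply/eqP; rewrite -size_eq0 -leqn0 leqNgt; apply/negP => h.
    have : nth (0, 0) new 0 \in new by rewrite mem_nth.
    move/tree_run_sub/by_load_vs; rewrite /inside (eqP vs0) //.
  have := num_labels_run_tree (st := (st.1, [::]))
    (s := by_load es (iota i (M - i)) trees) st_vs (@by_load_vs _ _).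
  rewrite addn0 -/new; suff : 0 < num_labels vs (foldl merge_edge (st.1, [::])
     (by_load es (iota i (M - i)) trees)).
    by rewrite -[num_labels vs (st.1, _)]/(num_labels vs st); lia.
  rewrite /num_labels -has_predT; case: (vs) vs0 => // v vs' _.
  apply/hasP; exists (label (foldl merge_edge (st.1, [::])
     (by_load es (iota i (M - i)) trees)) v) => //.
  by rewrite mem_undup mem_head.
have old e : e \in st.2 -> load trees e < i.
  by move=> /tree_run_sub; rewrite mem_by_load mem_iota add0n => /andP[].
apply: (@leq_trans (lam * (num_labels vs st).-1)).
  rewrite leq_mul2l; apply/orP; right; apply: leq_trans small_new.
  rewrite -size_filter; apply: uniq_leq_size; first exact: filter_uniq.
  move=> e; rewrite mem_filter def_T mem_cat => /andP[/andP[/orP[//|h]]].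
  by rewrite leqNgt old.
apply: leq_trans (crossing_edges_ge lam_le (label st)) _.
rewrite leq_mul2l /=; apply: count_sub_in => e ees.
apply: contraR; rewrite -ltnNge => li; apply/eqP.
apply: (label_run_closed st0_vs (@by_load_vs _ _)).
by rewrite mem_by_load ees mem_iota.
Qed.

Definition weight trees := \sum_(e <- es) 2 ^ load trees e.

(** [tree_edges_above], weighted by the increment of the power of two at each threshold and summed
    over all thresholds. *)
Lemma weight_of_tree trees : (forall e, e \in es -> load trees e < M) ->
  lam * (\sum_(e <- es | e \in tree trees) 2 ^ load trees e) <=
  2 * weight trees.
Proof.
move=> loads; pose c i := if i is j.+1 then 2 ^ j else 1.
have pow2 e : e \in es -> 2 ^ load trees e =
    \sum_(i < M.+1) (i <= load trees e) * c i.
  move=> ees; rewrite -sum_doubling (big_ord_widen M.+1 c).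
    rewrite big_mkcond; apply: eq_bigr => i _; rewrite ltnS.
    by case: (i <= _); rewrite ?mul1n.
  by apply: leqW; apply: loads.
have sum_pow2 (P : pred (nat * nat)) :
    \sum_(e <- es | P e) 2 ^ load trees e =
    \sum_(i < M.+1) c i * count (fun e => P e && (i <= load trees e)) es.
  rewrite big_seq_cond (eq_bigr (fun e =>
    \sum_(i < M.+1) (i <= load trees e) * c i)); last first.
    by move=> e /andP[/pow2].
  rewrite -big_seq_cond exchange_big /=; apply: eq_bigr => i _.
  rewrite count_sum big_distrr /= big_mkcond; apply: eq_bigr => e _.
  by case: (P e); rewrite /= ?muln0 // mulnC.
rewrite sum_pow2 /weight sum_pow2 !big_distrr /=; apply: leq_sum => i _.
by rewrite mulnCA [X in _ <= X]mulnCA leq_mul2l tree_edges_above ?orbT.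
Qed.

Definition packing n := iter n (fun trees => tree trees :: trees) [::].

Lemma size_packing n : size (packing n) = n.
Proof. by elim: n => //= n ->. Qed.

Lemma load_packing n e : load (packing n) e <= n.
Proof. by rewrite -{2}(size_packing n) count_size. Qed.

Lemma mem_packing n T : T \in packing n ->
  exists2 j, j < n & T = tree (packing j).
Proof.
elim: n => //= n IH; rewrite in_cons => /orP[/eqP->|/IH[j jn ->]].
  by exists n.
by exists j => //; apply: ltnW.
Qed.

Lemma packing_sub m n : m <= n -> {subset packing m <= packing n}.
Proof.
move=> /subnKC <-; elim: (n - m) => [|d IH] T Tm; first by rewrite addn0.
by rewrite addnS /= in_cons IH ?orbT.
Qed.

(** A new forest doubles the terms of its edges, so it adds to the potential its own part, at most 2
    / [lam] of the whole. Powers of [lam] are multiplied out to stay in [nat]. *)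
Lemma weight_packing n : n <= M ->
  lam ^ n * weight (packing n) <= (lam + 2) ^ n * size es.
Proof.
elim: n => [|n IH] nM.
  rewrite !expn0 !mul1n /weight -sum1_size; apply: leq_sum => e _ //.
rewrite [lam ^ _]expnSr [(_ + 2) ^ _]expnS -!mulnA.
apply: leq_trans (_ : (lam + 2) * (lam ^ n * weight (packing n)) <= _); last first.
  by rewrite leq_mul2l IH ?orbT // ltnW.
rewrite [X in _ <= X]mulnCA leq_mul2l; apply/orP; right.
have loads e : e \in es -> load (packing n) e < M.
  by move=> _; apply: leq_ltn_trans (load_packing n e) nM.
have -> : weight (packing n.+1) = weight (packing n) +
    \sum_(e <- es | e \in tree (packing n)) 2 ^ load (packing n) e.
  rewrite /weight [X in _ + X]big_mkcond -big_split /=; apply: eq_bigr => e _.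
  rewrite /load /= -/(load _ _); case: (e \in _); rewrite ?addn0 //.
  by rewrite add1n expnS mul2n addnn.
by rewrite mulnDr [X in _ <= X]mulnDl leq_add2l weight_of_tree.
Qed.

Section Saturated.
Hypotheses (lam_gt0 : 0 < lam) (lam_M : lam * size es <= M).

(** With m edges, 2 ^ load is at most the potential, which is at most 16 ^ m * m < 2 ^ (4 m) * 2 ^
    m. *)
Lemma load_saturated e : e \in es ->
  load (packing (lam * size es)) e < 5 * size es.
Proof.
move=> ees; have m_gt0 : 0 < size es by case: (es) ees.
have := weight_packing lam_M.
rewrite !expnM => h.
have : (lam ^ lam) ^ size es * weight (packing (lam * size es)) <=
       (lam ^ lam) ^ size es * (16 ^ size es * size es).
  apply: leq_trans h _; rewrite mulnA leq_mul2r -expnMn leq_expn2r ?orbT //.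
  by rewrite mulnC expn_bound.
rewrite leq_pmul2l ?expn_gt0 ?lam_gt0 // => {}h.
rewrite -(ltn_exp2l _ _ (isT : 1 < 2)).
apply: (@leq_ltn_trans (weight (packing (lam * size es)))).
  rewrite /weight (perm_big _ (perm_to_rem ees)) big_cons /=; exact: leq_addr.
apply: leq_ltn_trans h _; rewrite (_ : 5 = 4 + 1) // mulnDl expnD expnM mul1n.
by rewrite ltn_pmul2l ?expn_gt0 // ltn_expl.
Qed.

(** The incidences between the cut and the lam * m forests are counted twice: fewer than 5 m for
    each of the [lam] edges, against 5 for each forest if none met the cut in at most four edges. *)
Lemma tree_respecting A : cut_size es A = lam ->
  exists2 T, T \in packing (lam * size es) &
    count (fun e => (A e.1 != A e.2) && (e \in T)) es <= 4.
Proof.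
move=> A_lam; have [/hasP[T TP h]|/hasPn many] := boolP (has (fun T =>
   count (fun e => (A e.1 != A e.2) && (e \in T)) es <= 4)
   (packing (lam * size es))); first by exists T.
pose S := \sum_(e <- es | A e.1 != A e.2) load (packing (lam * size es)) e.
have S_ge : 5 * (lam * size es) <= S.
  have -> : S = \sum_(T <- packing (lam * size es))
      count (fun e => (A e.1 != A e.2) && (e \in T)) es.
    rewrite /S (eq_bigr (fun e => \sum_(T <- packing (lam * size es)) (e \in T))).
      rewrite exchange_big; apply: eq_bigr => T _; rewrite count_sum big_mkcond.
      by apply: eq_bigr => e _; case: (_ != _).
    by move=> e _; rewrite /load count_sum.
  rewrite -[X in _ * X](size_packing (lam * size es)) mulnC -sum1_size.
  rewrite big_distrl /= big_seq [X in _ <= X]big_seq; apply: leq_sum => T TP.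
  by rewrite mul1n ltnNge many.
have : S < 5 * (lam * size es).
  rewrite mulnCA -[X in _ < X * _]A_lam /cut_size count_sum /S big_distrl /= big_mkcond.
  rewrite big_seq [X in _ < X]big_seq.
  (* One crossing edge is singled out to make the inequality strict; it exists because [lam] is
     positive. *)
  have [e ees cross] : exists2 e, e \in es & A e.1 != A e.2.
    by apply/hasP; rewrite has_count -/(cut_size es A) A_lam.
  rewrite -!big_seq !(perm_big _ (perm_to_rem ees)) !big_cons cross mul1n.
  rewrite -addSn leq_add ?load_saturated //.
  rewrite big_seq [X in _ <= X]big_seq; apply: leq_sum => f /mem_rem fes.
  by case: ifP => // _; rewrite mul1n ltnW // load_saturated.
by rewrite ltnNge S_ge.
Qed.

End Saturated.

Lemma greedy_tree_spans trees B : (forall e, e \in es -> load trees e < M) ->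
  {in tree trees, forall e, B e.1 = B e.2 :> bool} ->
  {in es, forall e, B e.1 = B e.2}.
Proof.
move=> loads BT e ees; have /andP[e1 e2] := es_vs ees.
have st_vs := labelling_diag vs.
apply: (label_run_finest st_vs (@by_load_vs (iota 0 M) trees) _ BT) => //.
  by move=> x y xvs yvs; rewrite /label !lookup_diag // => ->.
apply: (label_run_closed st_vs (@by_load_vs _ _)).
by rewrite mem_by_load ees mem_iota loads.
Qed.

End Packing.

Lemma iota_sizeE A (s : seq A) : iota_size s = iota 0 (size s).
Proof.
elim/last_ind: s => //= s x IH.
rewrite /iota_size -cats1 foldl_cat -/(iota_size s) IH size_cat addn1 /=.
by rewrite -[1]addn0 iotaDl.
Qed.

Lemma mem_pairs (A B : eqType) (s : seq A) (t : seq B) a b :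
  ((a, b) \in pairs s t) = (a \in s) && (b \in t).
Proof.
apply/flattenP/andP => [[_ /mapP[a' a's ->]] /mapP[b' b't [-> ->]]|[as_ bt]] //.
by exists [seq (a, b') | b' <- t]; apply/mapP; [exists a | exists b].
Qed.

Lemma greedy_treesE vs es M :
  greedy_trees vs es (iota 0 M) = packing vs es M M.
Proof.
by rewrite /greedy_trees (foldl_iter (fun t => greedy_tree _ _ _ t :: t)) size_iota.
Qed.

(** * From the packing to the list of minimum cuts *)

Section Candidates.
Variables (vs : seq nat) (es : seq (nat * nat)).
Hypothesis es_vs : {in es, forall e, inside vs e}.
Hypothesis es_uniq : uniq es.

Let D := (0, 0) :: es.
(** A value the program can form without knowing the minimum: it is at least the size of a minimum
    cut times the number of edges, and it is positive even without edges. *)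
Let M := size D * size D.

Lemma candidatesP x : reflect
  (exists T q a b, [/\ T \in packing vs es M M,
     [/\ q.1.1 \in D, q.1.2 \in D, q.2.1 \in D & q.2.2 \in D],
     a \in vs, b \in vs &
     x \in candidate vs es (labels_without vs T q) (a, b)])
  (x \in candidates vs es).
Proof.
rewrite /candidates iota_sizeE size_pairs -/D -/M greedy_treesE.
apply: (iffP flattenP) => [[s /mapP[[T [[q1 q2] [q3 q4]]] TqP ->]]|].
  move: TqP; rewrite !mem_pairs => /andP[TP /andP[/andP[q1D q2D] /andP[q3D q4D]]].
  case/flattenP=> _ /mapP[[a b] abP ->] xc.
  move: abP; rewrite mem_pairs => /andP[av bv].
  by exists T, ((q1, q2), (q3, q4)), a, b.
case=> T [[[q1 q2] [q3 q4]] [a [b [TP [q1D q2D q3D q4D] av bv xc]]]].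
exists (candidates_from vs es (labels_without vs T (q1, q2, (q3, q4)))).
  by apply/mapP; exists (T, (q1, q2, (q3, q4))) => //;
    rewrite !mem_pairs TP q1D q2D q3D.
apply/flattenP; exists (candidate vs es
  (labels_without vs T (q1, q2, (q3, q4))) (a, b)) => //.
by apply/mapP; exists (a, b) => //; rewrite mem_pairs av.
Qed.

Lemma candidates_sound x : x \in candidates vs es ->
  exists2 A, nontrivial vs A & x = cut_of es A.
Proof.
case/candidatesP=> T [q [a [b [_ _ av bv]]]]; rewrite /candidate.
case: ifP => // h; rewrite mem_seq1 => /eqP->.
exists (side_of (labels_without vs T q) a b) => //.
apply/andP; split=> //; apply/hasP; exists a => //.
by rewrite /side_of eqxx.
Qed.

Lemma eq_cut_of A B : {in vs, A =1 B} -> cut_of es A = cut_of es B.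
Proof.
by move=> AB; apply/eq_in_map => e /es_vs/andP[e1 e2]; rewrite !AB.
Qed.

Lemma cut_of_predC A : cut_of es (fun x => ~~ A x) = cut_of es A.
Proof. by apply/eq_map => e; case: (A e.1); case: (A e.2). Qed.

Section TwoLabels.
Variables (L : seq (nat * nat)) (A : nat -> bool).
Hypothesis A_resp :
  {in vs &, forall x y, lookup L x = lookup L y -> A x = A y}.

Definition labels_in (B : nat -> bool) :=
  undup [seq lookup L x | x <- vs & B x].

Lemma side_of_two_labels : has A vs -> size (labels_in A) <= 2 ->
  exists a b, [/\ a \in vs, b \in vs & {in vs, A =1 side_of L a b}].
Proof.
move=> /hasP[x0 x0v Ax0]; have x0l : lookup L x0 \in labels_in A.
  by rewrite mem_undup; apply: map_f; rewrite mem_filter Ax0.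
have pre l : l \in labels_in A -> exists2 x, (x \in vs) && A x & l = lookup L x.
  by rewrite mem_undup => /mapP[x]; rewrite mem_filter andbC => xA ->; exists x.
have inA a b x : x \in vs -> a \in vs -> b \in vs -> A a -> A b ->
    side_of L a b x -> A x.
  move=> xv av bv Aa Ab /orP[]/eqP/A_resp.
    by move=> ->.
  by move=> ->.
have mem_l x : x \in vs -> A x -> lookup L x \in labels_in A.
  by move=> xv Ax; rewrite mem_undup; apply: map_f; rewrite mem_filter Ax.
case def_l: (labels_in A) x0l pre mem_l => [|l1 [|l2 [|]]] //= _ pre mem_l _.
  have [a /andP[av Aa] al] := pre l1 (mem_head _ _).
  exists a, a; split=> // x xv; apply/idP/idP => [Ax|]; last exact: inA.
  by have := mem_l x xv Ax; rewrite mem_seq1 al /side_of => ->.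
have [a /andP[av Aa] al] := pre l1 (mem_head _ _).
have [b /andP[bv Ab] bl] := pre l2 ltac:(by rewrite !in_cons eqxx orbT).
exists a, b; split=> // x xv; apply/idP/idP => [Ax|]; last exact: inA.
by have := mem_l x xv Ax; rewrite !in_cons in_nil orbF al bl.
Qed.

End TwoLabels.

Lemma candidate_of_two_labels T q (A : nat -> bool) :
  T \in packing vs es M M ->
  [/\ q.1.1 \in D, q.1.2 \in D, q.2.1 \in D & q.2.2 \in D] ->
  nontrivial vs A ->
  (exists a b, [/\ a \in vs, b \in vs &
     {in vs, A =1 side_of (labels_without vs T q) a b}]) ->
  cut_of es A \in candidates vs es.
Proof.
move=> TP qD /andP[_ /hasP[y yv nAy]] [a [b [av bv Aab]]].
apply/candidatesP; exists T, q, a, b; split=> //; rewrite /candidate /=.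
rewrite ifT; first by rewrite mem_seq1 (eq_cut_of Aab).
by apply/hasP; exists y => //; rewrite -Aab.
Qed.

Lemma load_packing_ltM n e : n < M -> load (packing vs es M n) e < M.
Proof. by move=> nM; apply: leq_ltn_trans (load_packing _ _ _ _ _) nM. Qed.

(* The labels left by a tree [T] deprived of the edges of [q], of which [(0, 0)]
   is a dummy: they refine [A] if [q] contains the edges of [T] crossing [A]. *)
Section Respecting.
Variables (n : nat) (q : (nat * nat) * (nat * nat) * ((nat * nat) * (nat * nat))).
Hypothesis n_lt : n < M.
Let T := greedy_tree vs es (iota 0 M) (packing vs es M n).
Let T' := [seq e <- T |
  ~~ [|| e == q.1.1, e == q.1.2, e == q.2.1 | e == q.2.2]].
Let st := merge_all vs T'.

Let T'_vs : {in T', forall e, inside vs e}.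
Proof. by move=> e; rewrite mem_filter => /andP[_ /greedy_tree_sub/es_vs]. Qed.

Let st_vs : labelling vs st.
Proof. exact: labelling_run (labelling_diag vs). Qed.

Lemma labels_without_closed e : e \in T' -> label st e.1 = label st e.2.
Proof. by move=> eT'; apply: (label_run_closed (labelling_diag vs) T'_vs). Qed.

Lemma labels_without_respects (A : nat -> bool) :
  {in T', forall e, A e.1 = A e.2} ->
  {in vs &, forall x y, label st x = label st y -> A x = A y}.
Proof.
move=> AT'; apply: label_run_finest (labelling_diag vs) T'_vs _ _ => //.
  by move=> x y xv yv; rewrite /label !lookup_diag // => ->.
by move=> e /tree_run_sub; apply: AT'.
Qed.

(** What remains of the forest, together with the four removed edges, still spans every component of
    the graph. *)
Lemma spans_without (B : nat -> bool) :
  {in T', forall e, B e.1 = B e.2} ->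
  (forall e, e \in [:: q.1.1; q.1.2; q.2.1; q.2.2] -> B e.1 = B e.2) ->
  {in es, forall e, B e.1 = B e.2}.
Proof.
move=> BT' Bq; apply: (@greedy_tree_spans vs es es_vs M (packing vs es M n)).
  by move=> e _; apply: load_packing_ltM.
move=> e eT; have [eq|neq] := boolP (e \in [:: q.1.1; q.1.2; q.2.1; q.2.2]).
  exact: Bq.
by apply: BT'; rewrite mem_filter eT andbT; move: neq; rewrite !in_cons in_nil orbF.
Qed.

End Respecting.

Lemma candidates_complete A : minimal vs es A -> cut_of es A \in candidates vs es.
Proof.
move=> [A_nt A_min]; have /andP[/hasP[x0 x0v Ax0] /hasP[y0 y0v nAy0]] := A_nt.
have M_gt0 : 0 < M by rewrite /M /D muln_gt0.
(* With no crossing edge there is nothing to average. The mask of [A] is then constantly false, and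
   so is that of the component of [x0], which the first forest provides. *)
have [lam0|lam_gt0] := posnP (cut_size es A).
  pose d := (0, 0); pose q := ((d, d), (d, d)); pose T :=
    greedy_tree vs es (iota 0 M) (packing vs es M 0).
  have TP : T \in packing vs es M M.
    by apply: (packing_sub M_gt0); rewrite mem_head.
  have A_es : {in es, forall e, A e.1 = A e.2}.
    move=> e ees; apply/eqP; apply: contraT => cr; move: lam0.
    move/eqP; rewrite -leqn0 leqNgt -has_count => /hasPn/(_ e ees).
    by rewrite cr.
  pose L := labels_without vs T q.
  have A_resp : {in vs &, forall x y, lookup L x = lookup L y -> A x = A y}.
    apply: labels_without_respects => e; rewrite mem_filter => /andP[_].
    by move/greedy_tree_sub/A_es.
  pose B x := lookup L x == lookup L x0.
  have B_es : {in es, forall e, B e.1 = B e.2}.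
    apply: (@spans_without 0 q M_gt0).
      by move=> e /labels_without_closed eq_e; rewrite /B /label in eq_e *;
        rewrite eq_e.
    (* All four removed edges are the dummy (0, 0), a loop, on which [B] agrees trivially. *)
    by move=> e; rewrite /q /= !in_cons in_nil orbF !orbb => /eqP->.
  have -> : cut_of es A = cut_of es B.
    by apply/eq_in_map => e ees; rewrite A_es // B_es // !eqxx.
  apply: (@candidate_of_two_labels T q) => //.
    apply/andP; split; first by apply/hasP; exists x0 => //; rewrite /B eqxx.
    apply/hasP; exists y0 => //; apply/negP => /eqP/A_resp; rewrite x0v y0v.
    by move/(_ isT isT) => Axy; move: nAy0; rewrite /= Axy Ax0.
  by exists x0, x0; split=> // x xv; rewrite /side_of orbb.
have lamM : cut_size es A * size es <= M.
  rewrite /M /D /=; have : cut_size es A <= size es by apply: count_size.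
  nia.
have [T TP A_T] := tree_respecting es_vs es_uniq A_min lam_gt0 lamM erefl.
have [n nlt def_T] := mem_packing TP; have nM := leq_trans nlt lamM.
have {}TP := packing_sub lamM TP.
pose F := [seq e <- es | (A e.1 != A e.2) && (e \in T)].
have F4 : size F <= 4 by rewrite size_filter.
(* The crossing edges of [T], padded to four by the dummy. *)
pose f i := nth (0, 0) F i; pose q := ((f 0, f 1), (f 2, f 3)).
have fD i : f i \in D.
  rewrite /f; have [iF|Fi] := ltnP i (size F); last
    by rewrite nth_default ?mem_head.
  have := mem_nth (0, 0) iF; rewrite mem_filter in_cons => /andP[_ ->].
  by rewrite orbT.
have fF e : e \in [:: f 0; f 1; f 2; f 3] -> e = (0, 0) \/ e \in F.
  have fi i : f i = (0, 0) \/ f i \in F.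
    rewrite /f; have [iF|Fi] := ltnP i (size F); last by left; rewrite nth_default.
    by right; apply: mem_nth.
  by rewrite !in_cons in_nil orbF => /or4P[]/eqP->; apply: fi.
have Ff e : e \in F -> e \in [:: f 0; f 1; f 2; f 3].
  move=> eF; rewrite -(nth_index (0, 0) eF) -/(f _).
  have : index e F < 4 by apply: leq_trans F4; rewrite index_mem.
  by case: (index e F) => [|[|[|[|]]]] // _; rewrite !in_cons eqxx ?orbT.
pose st := merge_all vs [seq e <- T |
  ~~ [|| e == q.1.1, e == q.1.2, e == q.2.1 | e == q.2.2]].
have T'_q e : e \in T -> e \notin [:: f 0; f 1; f 2; f 3] ->
    e \in [seq e <- T | ~~ [|| e == q.1.1, e == q.1.2, e == q.2.1 | e == q.2.2]].
  by move=> eT; rewrite mem_filter eT andbT !in_cons in_nil orbF.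
have A_resp : {in vs &, forall x y, label st x = label st y -> A x = A y}.
  rewrite /st def_T; apply: labels_without_respects => e.
  rewrite mem_filter => /andP[eq eT]; apply/eqP; apply: contraT => cr.
  have : e \in F by rewrite mem_filter cr def_T eT; apply: greedy_tree_sub eT.
  by move/Ff; rewrite !in_cons in_nil orbF (negbTE eq).
have st_vs : labelling vs st by exact: labelling_run (labelling_diag vs).
have F_vs : {in F, forall e, inside vs e}.
  by move=> e; rewrite mem_filter => /andP[_ /es_vs].
have := num_labels_run st_vs F_vs; set st2 := foldl _ st F => few.
(* [st2] puts the edges of [F] back. If two labels survived, the class of [x0] would be a nontrivial
   side that no edge crosses, although the minimum is positive. *)
have one : num_labels vs st2 <= 1.
  rewrite /num_labels -[1]/(size [:: label st2 x0]).
  apply: uniq_leq_size; first exact: undup_uniq.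
  move=> l; rewrite mem_undup mem_seq1 => /mapP[x xv ->]; apply: contraT => ne.
  pose B z := label st2 z == label st2 x0.
  have B_es : {in es, forall e, B e.1 = B e.2}.
    apply: (@spans_without n q nM) => e.
      rewrite -def_T => eT'; have eT : e \in T by move: eT';
        rewrite mem_filter => /andP[].
      rewrite /B; congr (_ == _); have /es_vs/andP[e1 e2] : e \in es.
        by move: eT; rewrite def_T => /greedy_tree_sub.
      apply: (label_run_coarsens st_vs F_vs e1 e2).
      by move: eT'; rewrite /st def_T => /labels_without_closed.
    case/fF=> [->//|eF]; rewrite /B; congr (_ == _).
    exact: (label_run_closed st_vs F_vs).
  have : nontrivial vs B.
    apply/andP; split; apply/hasP; first by exists x0; rewrite /B.
    by exists x.
  move/A_min; rewrite leqNgt; case/negP; apply: leq_trans lam_gt0.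
  rewrite ltnS leqn0 /cut_size; apply/eqP/eqP; rewrite -leqn0 leqNgt -has_count.
  by apply/hasPn => e ees; rewrite B_es // eqxx.
have five : num_labels vs st <= 5 by apply: leq_trans few (leq_add one F4).
pose L := labels_without vs T q.
have nA_resp : {in vs &, forall x y, lookup L x = lookup L y -> ~~ A x = ~~ A y}.
  by move=> x y xv yv /(A_resp x y xv yv)->.
(* No label occurs on both sides of [A] and there are at most five, so one side has at most two. The
   mask does not depend on which side is used. *)
have split_labels : size (labels_in L A) + size (labels_in L (fun x =>
  ~~ A x)) <= 5.
  apply: leq_trans five; rewrite -size_cat; apply: uniq_leq_size.
    rewrite cat_uniq !undup_uniq andbT /=; apply/hasPn => l.
    rewrite /= !mem_undup => /mapP[x]; rewrite mem_filter => /andP[nAx xv] ->.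
    apply/mapP => -[y]; rewrite mem_filter => /andP[Ay yv] /(A_resp x y xv yv).
    by move=> Axy; move: nAx; rewrite Axy Ay.
  move=> l; rewrite mem_cat !mem_undup => /orP[]/mapP[x]; rewrite mem_filter;
    by case/andP=> _ xv ->; apply: map_f.
have qD : [/\ q.1.1 \in D, q.1.2 \in D, q.2.1 \in D & q.2.2 \in D] by split;
  apply: fD.
have [le2|gt2] := leqP (size (labels_in L A)) 2.
  apply: (candidate_of_two_labels TP qD A_nt); apply: side_of_two_labels => //.
  by apply/hasP; exists x0.
rewrite -cut_of_predC; apply: (candidate_of_two_labels TP qD).
  apply/andP; split; apply/hasP; first by exists y0.
  by exists x0; rewrite //= negbK.
apply: side_of_two_labels => //; first by apply/hasP; exists y0.
by rewrite -(leq_add2l 3) (leq_trans (leq_add gt2 (leqnn _)) split_labels).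
Qed.

Lemma count_cut_of A : count id (cut_of es A) = cut_size es A.
Proof. by rewrite /cut_of count_map; apply: eq_count. Qed.

Lemma exists_minimal A : nontrivial vs A -> exists B, minimal vs es B.
Proof.
have [n] := ubnP (cut_size es A); elim: n A => // n IH A An A_nt.
have [[B [B_nt BA]]|none] := boolp.pselect (exists B, nontrivial vs B /\
    cut_size es B < cut_size es A).
  by apply: IH B_nt; apply: leq_trans BA _; rewrite -ltnS.
exists A; split=> // B B_nt; rewrite leqNgt; apply/negP => BA.
by apply: none; exists B.
Qed.

End Candidates.

Lemma mem_dedup (A : eqType) (s : seq A) : dedup s =i s.
Proof.
rewrite /dedup => x; rewrite -[RHS]/((x \in [::]) || (x \in s)).
elim: s [::] => [|y s IH] acc /=; first by rewrite orbF.
rewrite IH in_cons; case: ifP => [yacc|_]; last by rewrite in_cons orbCA orbA.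
by case: (eqVneq x y) => [->|]; rewrite ?yacc.
Qed.

Lemma dedup_uniq (A : eqType) (s : seq A) : uniq (dedup s).
Proof.
rewrite /dedup; have: uniq ([::] : seq A) by [].
elim: s [::] => //= x s IH acc acc_uniq; apply: IH.
by case: ifP => //= ->.
Qed.

(** All candidates are cuts and all minimum cuts are candidates, so the least size among the
    candidates is the true minimum. *)
Lemma min_cutsP vs es x : {in es, forall e, inside vs e} -> uniq es ->
  reflect (exists2 A, minimal vs es A & x = cut_of es A) (x \in min_cuts vs es).
Proof.
move=> es_vs es_uniq; rewrite /min_cuts mem_dedup mem_filter.
apply: (iffP andP) => [[/allP x_min xM]|[A A_min ->]].
  have [A A_nt def_x] := candidates_sound xM; exists A => //; split=> // B B_nt.
  have [C C_min] := exists_minimal es B_nt.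
  apply: leq_trans (C_min.2 _ B_nt).
  have := x_min _ (candidates_complete es_vs es_uniq C_min).
  by rewrite def_x !count_cut_of.
split; last exact: candidates_complete.
apply/allP => y /candidates_sound[B B_nt ->].
by rewrite !count_cut_of; apply: A_min.2.
Qed.

(** * Dispersion in metrics of negative type *)

Local Open Scope ring_scope.

Lemma sum_const_seq (R : pzSemiRingType) (T : Type) (s : seq T) (c : R) :
  \sum_(x <- s) c = (size s)%:R * c.
Proof. by rewrite big_const_seq count_predT iter_addr_0 mulr_natl. Qed.

Section Dispersion.
Variables (R : realFieldType) (T : eqType) (d : T -> T -> R).
Implicit Types X Y : seq T.

Definition cross X Y : R := \sum_(x <- X) \sum_(y <- Y) d x y.

Hypothesis d_ge0 : forall x y, 0 <= d x y.
Hypothesis d_sym : forall x y, d x y = d y x.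
Hypothesis d_refl : forall x, d x x = 0.
Hypothesis d_triangle : forall x y z, d x y <= d x z + d z y.
(** Negative type for the coefficients 1 on [X] and -1 on [Y], which sum to 0 as the sizes agree. *)
Hypothesis d_negative_type : forall X Y, size X = size Y ->
  cross X X + cross Y Y <= 2 * cross X Y.

Lemma cross_ge0 X Y : 0 <= cross X Y.
Proof. by apply: sumr_ge0 => x _; apply: sumr_ge0. Qed.

Lemma cross_sym X Y : cross X Y = cross Y X.
Proof.
by rewrite /cross exchange_big; apply: eq_bigr => x _; apply: eq_bigr => y _.
Qed.

Lemma cross_cons x X Y : cross (x :: X) Y = \sum_(y <- Y) d x y + cross X Y.
Proof. by rewrite /cross big_cons. Qed.

Lemma perm_cross X X' Y Y' :
  perm_eq X X' -> perm_eq Y Y' -> cross X Y = cross X' Y'.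
Proof.
move=> XX' YY'; rewrite /cross (perm_big _ XX'); apply: eq_bigr => x _.
exact: perm_big.
Qed.

Lemma cross_filter (p : pred T) X Y :
  cross X Y = cross [seq x <- X | p x] Y + cross [seq x <- X | ~~ p x] Y.
Proof. by rewrite /cross !big_filter (bigID p). Qed.

Lemma cross_diag_cons x X : cross (x :: X) (x :: X) =
  cross X X + 2 * \sum_(y <- X) d x y.
Proof.
rewrite cross_cons big_cons d_refl add0r [cross X (x :: X)]cross_sym cross_cons.
ring.
Qed.

Lemma cross_swap S x y : uniq S -> x \in S ->
  cross (y :: [seq z <- S | z != x]) (y :: [seq z <- S | z != x]) =
  cross S S + 2 * (\sum_(z <- S) d y z - \sum_(z <- S) d x z - d x y).
Proof.
move=> S_uniq xS; have perm_S : perm_eq S (x :: [seq z <- S | z != x]).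
  by rewrite -rem_filter // perm_to_rem.
rewrite (perm_cross perm_S perm_S) !cross_diag_cons.
rewrite [\sum_(z <- S) d y z](perm_big _ perm_S).
rewrite [\sum_(z <- S) d x z](perm_big _ perm_S) /= !big_cons.
rewrite d_refl (d_sym y x); ring.
Qed.

Section LocalOptimum.
Variables (S O : seq T) (tau : R).
Hypotheses (S_uniq : uniq S) (O_uniq : uniq O) (sizeSO : size S = size O).
Hypothesis tau_ge0 : 0 <= tau.
(** As [cross] counts ordered pairs, [tau] is the tolerance per unordered pair. *)
Hypothesis local_opt : forall x y, x \in S -> y \in O -> y \notin S ->
  cross (y :: [seq z <- S | z != x]) (y :: [seq z <- S | z != x]) <=
  cross S S + 2 * tau.

Local Notation X := [seq x <- O | x \notin S].
Local Notation Y := [seq y <- S | y \notin O].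

Let k : R := (size S)%:R.
Let r : R := (size Y)%:R.

Let common : perm_eq [seq x <- O | ~~ (x \notin S)] [seq y <- S | ~~ (y \notin O)].
Proof.
apply: uniq_perm; rewrite ?filter_uniq // => x.
by rewrite !mem_filter !negbK andbC.
Qed.

Let sizeX : (size X)%:R = r.
Proof.
congr (_%:R); have := sizeSO.
rewrite -(count_predC (fun x => x \notin S) O) -(count_predC (fun y =>
  y \notin O) S).
have := perm_size common; rewrite !size_filter.
rewrite (eq_count (a2 := predC (fun x => x \notin S))) //.
rewrite [X in _ = X -> _](eq_count (a2 := predC (fun x => x \notin O))) //.
by move=> -> /eqP; rewrite eqn_add2r => /eqP->.
Qed.

Let g := cross O S - cross S S.

Let gE : g = cross X S - cross Y S.
Proof.
rewrite /g (cross_filter (fun x => x \notin S) O) (cross_filter (fun y =>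
  y \notin O) S S).
by rewrite (perm_cross common (perm_refl S)); ring.
Qed.

(** By [cross_swap], a failed swap of y in [Y] for x in [X] says that d(x, S) - d(y, S) <= d(x, y) +
    tau. This is summed over all pairs, and both sets have [r] points. *)
Let swaps_bound : r * g <= cross X Y + r ^+ 2 * tau.
Proof.
rewrite gE mulrBr -{1}sizeX.
have h : \sum_(x <- X) \sum_(y <- Y) (\sum_(z <- S) d x z - \sum_(z <- S) d y z) <=
         \sum_(x <- X) \sum_(y <- Y) (d x y + tau).
  rewrite big_seq [leRHS]big_seq; apply: ler_sum => x.
  rewrite mem_filter => /andP[xS xO]; rewrite big_seq [leRHS]big_seq.
  apply: ler_sum => y; rewrite mem_filter => /andP[yO yS].
  have := local_opt yS xO xS; rewrite cross_swap // (d_sym y x); lra.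
have <- : \sum_(x <- X) \sum_(y <- Y) (d x y + tau) = cross X Y + r ^+ 2 * tau.
  rewrite /cross; under eq_bigr do rewrite big_split.
  by rewrite big_split; congr (_ + _); rewrite !sum_const_seq sizeX expr2 mulrA.
apply: le_trans h; rewrite le_eqVlt; apply/orP; left; apply/eqP.
under eq_bigr do rewrite sumrB.
rewrite sumrB; congr (_ - _).
  rewrite /cross sizeX mulr_sumr; apply: eq_bigr => x _.
  by rewrite sum_const_seq.
by rewrite sum_const_seq sizeX.
Qed.

(** The triangle inequality is summed over every intermediate point of [O]; afterwards [X] is
    enlarged to [O] and [Y] to [S]. *)
Let triangle_bound : k * cross X Y <= r * (cross O O + cross O S).
Proof.
have -> : k = (size O)%:R by rewrite /k sizeSO.
have h : \sum_(x <- X) \sum_(y <- Y) \sum_(z <- O) d x y <=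
         \sum_(x <- X) \sum_(y <- Y) \sum_(z <- O) (d x z + d z y).
  by do 3 (apply: ler_sum => ? _).
have le_part (p : pred T) U V : cross [seq u <- U | p u] V <= cross U V.
  by rewrite [leRHS](cross_filter p) lerDl cross_ge0.
apply: (@le_trans _ _ (\sum_(x <- X) \sum_(y <- Y) \sum_(z <- O) d x y)).
  rewrite /cross mulr_sumr; apply: ler_sum => x _; rewrite mulr_sumr.
  apply: ler_sum => y _.
  by rewrite sum_const_seq.
apply: le_trans h _.
have -> : \sum_(x <- X) \sum_(y <- Y) \sum_(z <- O) (d x z + d z y) =
    r * cross X O + r * cross O Y.
  under eq_bigr do (under eq_bigr do rewrite big_split; rewrite big_split /=).
  rewrite big_split /=; congr (_ + _).
    rewrite /cross mulr_sumr; apply: eq_bigr => x _.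
    by rewrite sum_const_seq.
  rewrite sum_const_seq sizeX.
  by rewrite /cross exchange_big.
rewrite -mulrDr ler_wpM2l ?ler0n // lerD //.
by rewrite [cross O Y]cross_sym [leRHS]cross_sym.
Qed.

Lemma local_optimum_gap : cross S S <= cross O O ->
  (k - 1) * (cross O O - cross S S) <= 4 * cross O O + 2 * k ^+ 2 * tau.
Proof.
move=> SO; have neg : cross O O - cross S S <= 2 * g.
  by have := d_negative_type (esym sizeSO); rewrite /g; lra.
have [S0|S_gt0] := posnP (size S).
  have -> : S = [::] by apply: size0nil.
  have -> : O = [::] by apply: size0nil; rewrite -sizeSO.
  by rewrite /cross !big_nil !subr0 !mulr0 add0r !mulr_ge0 // sqr_ge0.
have k_ge1 : 1 <= k by rewrite ler1n.
have rk : r <= k.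
  by rewrite ler_nat size_filter count_size.
have O_ge0 : 0 <= cross O O by apply: cross_ge0.
have [Y0|Y_gt0] := posnP (size Y).
  have r0 : r = 0 by rewrite /r Y0.
  have X0 : X = [::].
    by apply: size0nil; apply/eqP; rewrite -(eqr_nat R) sizeX r0.
  have g0 : g = 0 by rewrite gE X0 (size0nil Y0) /cross !big_nil subrr.
  apply: (@le_trans _ _ 0).
    by rewrite mulr_ge0_le0 ?subr_ge0 //; move: neg; rewrite g0 mulr0.
  by rewrite addr_ge0 ?mulr_ge0 ?sqr_ge0.
have r_gt0 : 0 < r by rewrite ltr0n.
have bound : k * g <= cross O O + cross O S + k ^+ 2 * tau.
  rewrite -(ler_pM2l r_gt0); apply: (@le_trans _ _ (k * (r * g))).
    by rewrite mulrCA.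
  apply: (@le_trans _ _ (k * (cross X Y + r ^+ 2 * tau))).
    by rewrite ler_wpM2l ?ler0n.
  rewrite mulrDr [leRHS]mulrDr; apply: lerD => //.
  have -> : k * (r ^+ 2 * tau) = (r * k * tau) * r by ring.
  have -> : r * (k ^+ 2 * tau) = (r * k * tau) * k by ring.
  by rewrite ler_wpM2l // !mulr_ge0 ?ler0n.
have : (k - 1) * (cross O O - cross S S) <= (k - 1) * (2 * g).
  by rewrite ler_wpM2l // subr_ge0.
(* Here cross(O, S) = g + cross(S, S) <= g + cross(O, O), which uses up one of the [k] copies of
   g. *)
have : (k - 1) * g <= 2 * cross O O + k ^+ 2 * tau.
  have -> : (k - 1) * g = k * g - g by ring.
  by move: bound; rewrite /g; lra.
lra.
Qed.

End LocalOptimum.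

End Dispersion.

(** * Local search *)

Lemma foldl_sum (R : nmodType) (T : Type) (f : T -> R) (s : seq T) :
  foldl (fun r a => r + f a) 0 s = \sum_(a <- s) f a.
Proof.
rewrite -[RHS]add0r; move: {1 2}0 => r.
elim: s r => [|a s IH] r /=; first by rewrite big_nil addr0.
by rewrite IH big_cons addrA.
Qed.

Lemma sum_pairs (R : nmodType) (A B : Type) (f : A * B -> R) s t :
  \sum_(p <- pairs s t) f p = \sum_(a <- s) \sum_(b <- t) f (a, b).
Proof. by rewrite big_flatten big_map; apply: eq_bigr => a _; rewrite big_map. Qed.

(** * Weighted Hamming distance *)

Section WeightedHamming.
Variables (R : realType) (w : seq R).
Hypothesis w_ge0 : {in w, forall c, 0 <= c}.

Definition hamming (x y : seq bool) : R :=
  \sum_(i < size w) nth 0 w i * (nth false x i != nth false y i)%:R.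

Lemma cut_dist_hamming x y : size x = size w -> size y = size w ->
  cut_dist w x y = hamming x y.
Proof.
move=> sx sy; rewrite /cut_dist foldl_sum (big_nth (0, (false, false))) big_mkord.
rewrite !size_zip sx sy !minnn; apply: eq_bigr => i _.
rewrite !nth_zip ?size_zip ?sx ?sy ?minnn //=.
by case: eqP => _; rewrite ?mulr1 ?mulr0.
Qed.

Lemma weight_ge0 i : 0 <= nth 0 w i.
Proof.
have [iw|wi] := ltnP i (size w); last by rewrite nth_default.
by apply: w_ge0; apply: mem_nth.
Qed.

Lemma hamming_ge0 x y : 0 <= hamming x y.
Proof. by apply: sumr_ge0 => i _; rewrite mulr_ge0 ?weight_ge0 ?ler0n. Qed.

Lemma hamming_sym x y : hamming x y = hamming y x.
Proof. by apply: eq_bigr => i _; rewrite eq_sym. Qed.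

Lemma hamming_refl x : hamming x x = 0.
Proof. by rewrite /hamming big1 // => i _; rewrite eqxx mulr0. Qed.

Lemma hamming_triangle x y z : hamming x y <= hamming x z + hamming z y.
Proof.
rewrite -big_split /=; apply: ler_sum => i _; rewrite -mulrDr.
rewrite ler_wpM2l ?weight_ge0 // -natrD ler_nat.
by case: (nth _ x i); case: (nth _ y i); case: (nth _ z i).
Qed.

(** For bits a and b, the indicator of a != b is a + b - 2 a b, so each coordinate depends only on
    the number of ones in [X] and in [Y]. *)
Lemma cross_hamming X Y : cross hamming X Y =
  \sum_(i < size w) nth 0 w i *
    (\sum_(x <- X) (nth false x i)%:R * (size Y)%:R +
     \sum_(y <- Y) (nth false y i)%:R * (size X)%:R -
     2 * (\sum_(x <- X) (nth false x i)%:R) * (\sum_(y <- Y) (nth false y i)%:R)).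
Proof.
rewrite /cross; under eq_bigr do rewrite exchange_big /=.
rewrite exchange_big /=; apply: eq_bigr => i _.
under eq_bigr do rewrite -mulr_sumr.
rewrite -mulr_sumr; congr (_ * _).
have -> : \sum_(x <- X) \sum_(y <- Y) (nth false x i != nth false y i)%:R =
    \sum_(x <- X) ((nth false x i)%:R * (size Y)%:R + (\sum_(y <- Y) (nth false y i)%:R -
      2 * (nth false x i)%:R * \sum_(y <- Y) (nth false y i)%:R)) :> R.
  apply: eq_bigr => x _; rewrite [_ * (size Y)%:R]mulrC -sum_const_seq.
  rewrite mulr_sumr -sumrB -big_split /=; apply: eq_bigr => y _.
  by case: (nth _ x i); case: (nth _ y i); rewrite /=; ring.
rewrite big_split sumrB /= sum_const_seq -!mulr_suml -!mulr_sumr; ring.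
Qed.

(** In each coordinate the difference of the two sides is 2 (p - q) ^ 2, where p and q count the
    ones in [X] and in [Y]. *)
Lemma hamming_negative_type X Y : size X = size Y ->
  cross hamming X X + cross hamming Y Y <= 2 * cross hamming X Y.
Proof.
move=> XY; rewrite !cross_hamming -big_split mulr_sumr /=; apply: ler_sum => i _.
rewrite mulrCA -mulrDr ler_wpM2l ?weight_ge0 // -!mulr_suml XY.
set p := \sum_(x <- X) _; set q := \sum_(y <- Y) _; set n := _%:R.
rewrite -subr_ge0 (_ : _ - _ = 2 * (p - q) ^+ 2); last by ring.
by rewrite mulr_ge0 ?sqr_ge0.
Qed.

Lemma dispersion_cross S : {in S, forall x, size x = size w} ->
  dispersion w S = cross hamming S S.
Proof.
move=> S_size; rewrite /dispersion foldl_sum sum_pairs /cross.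
rewrite big_seq [RHS]big_seq; apply: eq_bigr => x xS.
rewrite big_seq [RHS]big_seq; apply: eq_bigr => y yS.
by rewrite cut_dist_hamming ?S_size.
Qed.

End WeightedHamming.

Section Search.
Variables (R : realType) (w : seq R).

Lemma best_ge S L S' : S' \in S :: L ->
  dispersion w S' <= dispersion w (best w S L).
Proof.
rewrite /best; elim: L S S' => [|S1 L IH] S S' /=.
  by rewrite mem_seq1 => /eqP->.
rewrite !in_cons => /or3P[/eqP->|/eqP->|S'L].
- by case: ifP => h; [apply: le_trans h _|]; apply: IH; rewrite mem_head.
- case: ifP => [_|/negbT]; first by apply: IH; rewrite mem_head.
  by rewrite -ltNge => /ltW h; apply: le_trans h _; apply: IH; rewrite mem_head.
- by apply: IH; rewrite in_cons S'L orbT.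
Qed.

Variable pts : seq (seq bool).
Hypothesis pts_size : {in pts, forall x, size x = size w}.
Hypothesis w_ge0 : {in w, forall c, 0 <= c}.

Definition selection k S := [/\ uniq S, {subset S <= pts} & size S = k].

Lemma selection_dispersion k S : selection k S ->
  dispersion w S = cross (hamming w) S S.
Proof. by case=> _ S_pts _; apply: dispersion_cross => x /S_pts/pts_size. Qed.

Lemma mem_swaps S S' : reflect
  (exists x y, [/\ x \in S, y \in pts, y \notin S & S' = swap S x y])
  (S' \in swaps pts S).
Proof.
apply: (iffP mapP) => [[[x y]]|[x [y [xS yp yS ->]]]].
  case/flattenP=> _ /mapP[x' x'S ->] /mapP[y' + [-> ->]] ->.
  by rewrite mem_filter => /andP[yS yp]; exists x', y'.
exists (x, y) => //; apply/flattenP.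
exists [seq (x, b) | b <- [seq z <- pts | z \notin S]]; first by apply/mapP;
  exists x.
by apply/mapP; exists y; rewrite // mem_filter yS.
Qed.

Lemma selection_swap k S S' : selection k S -> S' \in swaps pts S ->
  selection k S'.
Proof.
case=> S_uniq S_pts S_size /mem_swaps[x [y [xS yp yS ->]]]; split.
- by rewrite /swap /= mem_filter (negbTE yS) andbF filter_uniq.
- move=> z; rewrite in_cons mem_filter => /orP[/eqP->//|/andP[_]].
  exact: S_pts.
- rewrite /swap /= -rem_filter // size_rem // S_size.
  by case: k S_size xS => // /size0nil ->.
Qed.

Lemma selection_best k S : selection k S -> selection k (best w S (swaps pts S)).
Proof.
move=> vS; have := best_mem w S (swaps pts S); rewrite in_cons.
by case/orP=> [/eqP->|] //; apply: selection_swap.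
Qed.

Variables (k : nat) (O : seq (seq bool)).
Hypothesis O_sel : selection k O.
Hypothesis O_opt : forall S, selection k S -> dispersion w S <= dispersion w O.

Let step S := best w S (swaps pts S).

Let selection_iter n S : selection k S -> selection k (iter n step S).
Proof. by move=> vS; elim: n => //= n; apply: selection_best. Qed.

Let dispersion_iter m n S :
  (m <= n)%N -> dispersion w (iter m step S) <= dispersion w (iter n step S).
Proof.
move=> /subnKC <-; elim: (n - m)%N => [|d IH]; first by rewrite addn0.
by rewrite addnS; apply: le_trans IH _; apply: best_ge; rewrite mem_head.
Qed.

Lemma local_search_iter S : size S = k ->
  local_search w pts S = iter (k ^ 2) step S.
Proof.
by move=> sS; rewrite /local_search (foldl_iter step) size_pairs sS mulnn.
Qed.

Lemma selection_local_search S : selection k S ->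
  selection k (local_search w pts S).
Proof. by move=> vS; rewrite local_search_iter;
  [apply: selection_iter|case: vS]. Qed.

Lemma dispersion_ge0 S : selection k S -> 0 <= dispersion w S.
Proof.
by move/selection_dispersion->; apply: cross_ge0 => x y; apply: hamming_ge0.
Qed.

(* The swaps gain at most [dispersion w O] in total, so one of the [k ^ 2]
   rounds gains at most the fraction [1 / k ^ 2] of it. *)
Lemma local_search_gap S : selection k S -> (2 <= k)%N ->
  k%:R * (dispersion w O - dispersion w (local_search w pts S)) <=
  12%:R * dispersion w O.
Proof.
move=> vS k_ge2; pose V n := dispersion w (iter n step S).
have k_ge2R : 2 <= k%:R :> R by rewrite ler_nat.
have O_ge0 := dispersion_ge0 O_sel.
pose c := dispersion w O / (k ^ 2)%:R.
have k2_gt0 : 0 < (k ^ 2)%:R :> R by rewrite ltr0n expn_gt0; lia.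
have [n n_lt gain] : exists2 n, (n < k ^ 2)%N & V n.+1 <= V n + c.
  have [/existsP[n h]|/existsPn h] :=
    boolP [exists n : 'I_(k ^ 2), V n.+1 <= V n + c].
    by exists n.
  have up n : (n <= k ^ 2)%N -> V 0%N + n%:R * c <= V n.
    elim: n => [|n IH] nk; first by rewrite mul0r addr0.
    have := h (Ordinal nk); rewrite -ltNge /= => /ltW; apply: le_trans.
    by rewrite -natr1 mulrDl mul1r addrA lerD2r IH // ltnW.
  have m_lt : ((k ^ 2).-1 < k ^ 2)%N by rewrite prednK // expn_gt0; lia.
  have := h (Ordinal m_lt); rewrite -ltNge /= prednK; last by rewrite expn_gt0; lia.
  have Vk : V (k ^ 2)%N <= dispersion w O by apply/O_opt/selection_iter.
  have V0 : 0 <= V 0%N by apply: dispersion_ge0.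
  have := up _ (ltnW m_lt).
  have -> : (k ^ 2).-1%:R * c = dispersion w O - c.
    have -> : dispersion w O = (k ^ 2).-1.+1%:R * c.
      rewrite prednK; last by rewrite expn_gt0; lia.
      by rewrite /c mulrCA divff ?mulr1 // gt_eqF.
    by rewrite -natr1; ring.
  by move=> ? ?; exfalso; lra.
set S' := iter n step S; have vS' : selection k S' by apply: selection_iter.
have VS' : V n = cross (hamming w) S' S' by apply: selection_dispersion vS'.
have VO : dispersion w O = cross (hamming w) O O
  by apply: selection_dispersion O_sel.
have [S'_uniq S'_pts S'_size] := vS'; have [O_uniq O_pts O_size] := O_sel.
(* The tolerance is c / 2 because [local_optimum_gap] allows a gain of twice [tau]. *)
have c_ge0 : 0 <= c / 2 by rewrite !divr_ge0.
have := @local_optimum_gap R _ (hamming w) (hamming_ge0 w_ge0) (hamming_sym w)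
  (hamming_refl w) (hamming_triangle w_ge0) (hamming_negative_type w_ge0)
  S' O (c / 2) S'_uniq O_uniq _ c_ge0 _ _.
rewrite S'_size O_size => /(_ erefl) gap.
have {}gap : (k%:R - 1) * (dispersion w O - V n) <=
    4 * dispersion w O + 2 * k%:R ^+ 2 * (c / 2).
  rewrite VS' VO; apply: gap; last by rewrite -VS' -VO; apply: O_opt.
  move=> x y xS yO yS; rewrite -VS' -[X in X <= _](@selection_dispersion k).
    rewrite (_ : 2 * (c / 2) = c); last by field.
    apply: le_trans gain; apply: best_ge; rewrite in_cons; apply/orP; right.
    by apply/mem_swaps; exists x, y; split=> //; apply: O_pts.
  apply: selection_swap vS' _; apply/mem_swaps; exists x, y; split=> //.
  exact: O_pts.
have kc : 2 * k%:R ^+ 2 * (c / 2) = dispersion w O.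
  rewrite /c natrX; field; rewrite pnatr_eq0; lia.
rewrite kc in gap; rewrite local_search_iter; last by case: vS.
have mono : V n <= V (k ^ 2)%N by apply: dispersion_iter (ltnW n_lt).
rewrite -/(V (k ^ 2)%N).
have h0 : dispersion w O - V (k ^ 2)%N <= dispersion w O - V n by lra.
have [neg|pos] := lerP (dispersion w O - V n) 0.
  apply: (@le_trans _ _ 0); last by rewrite mulr_ge0.
  by rewrite mulr_ge0_le0 ?ler0n // (le_trans h0).
apply: (@le_trans _ _ (k%:R * (dispersion w O - V n))).
  by rewrite ler_wpM2l ?ler0n.
(* As k >= 2, k <= 2 (k - 1); the gap bound 5 then becomes 10, below the 12 of the statement. *)
apply: (@le_trans _ _ (2 * ((k%:R - 1) * (dispersion w O - V n)))).
  by rewrite mulrA ler_wpM2r ?(ltW pos) //; lra.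
lra.
Qed.

Lemma subsetsP A (U : seq A) S :
  reflect (selection (size U) S) (S \in subsets pts U).
Proof.
suff sE n T : (T \in iter n (extend pts) [:: [::]]) =
  [&& uniq T, all (mem pts) T & size T == n].
  have -> : subsets pts U = iter (size U) (extend pts) [:: [::]].
    by rewrite /subsets foldl_iter.
  rewrite sE; apply: (iffP and3P) => [[uS /allP pS /eqP sS]|[uS pS sS]]; split=> //.
    exact/allP.
  exact/eqP.
elim: n T => [|n IH] T /=.
  by rewrite mem_seq1; case: T => //= y X; rewrite !andbF.
apply/flattenP/and3P => [[_ /mapP[X + ->]] /mapP[y + ->]|].
  rewrite IH mem_filter => /and3P[uX pX /eqP sX] /andP[yX yp].
  by rewrite /= yX uX yp pX sX.
case: T => [[]//|y X] /= [/andP[yX uX] /andP[yp pX] sX].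
exists [seq y :: X | y <- [seq y <- pts | y \notin X]].
  by apply/mapP; exists X; rewrite // IH uX pX.
by apply/mapP; exists y; rewrite // mem_filter yX.
Qed.

End Search.

(** * The approximation scheme *)

Lemma first_pointsE pts k :
  first_points pts k = (minn k (size pts), rev (take k pts)).
Proof.
elim/last_ind: pts => [|pts x IH]; first by rewrite minn0.
rewrite /first_points -cats1 foldl_cat -/(first_points pts k) IH /= gtn_min ltnn /=.
rewrite size_cat addn1 cats1; case: ltnP => h.
  rewrite !take_oversize ?size_rcons //; last exact: ltnW.
  by rewrite rev_rcons; congr (_, _); lia.
by rewrite -cats1 takel_cat //; congr (_, _); lia.
Qed.

(** The output must equal [encode_set] literally, in the order of [enum]; selecting from the list of
    all edges by a mask preserves this order. *)
Lemma enum_subset (T : finType) (A B : {set T}) : A \subset B ->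
  enum A = [seq x <- enum B | x \in A].
Proof.
move=> /subsetP AB; rewrite /enum_mem -filter_predI; apply: eq_filter => x /=.
by case: (boolP (x \in A)) => //= /AB->.
Qed.

Section ShortPrefix.
Variables (R : realType) (eps : R).
Hypothesis eps_gt0 : 0 < eps.

Lemma short_prefixP S : let st := short_prefix eps S in
  [/\ st.1 = eps * (size st.2)%:R, st.1 < 12%:R -> size st.2 = size S
    & st.1 < 12%:R + eps].
Proof.
elim/last_ind: S => [|S x IH].
  by rewrite /= mulr0; split=> //; rewrite addr_gt0 ?ltr0n.
rewrite /short_prefix -cats1 foldl_cat -/(short_prefix eps S) /=.
case: IH; case: (short_prefix eps S) => r U /= rE rS r_lt.
case: ifPn => [h|]; first by split=> //; rewrite ltNge h.
rewrite -ltNge /= => h; split; [|by rewrite size_cat addn1 rS|by rewrite ltrD2r].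
by rewrite rE -natr1 mulrDr mulr1.
Qed.

Lemma short_prefix_bounded : exists K, forall S, (size (short_prefix eps S).2 <= K)%N.
Proof.
exists (Num.bound ((12%:R + eps) / eps)) => S.
have [rE _ r_lt] := short_prefixP S.
have pos : 0 <= (12%:R + eps) / eps by rewrite divr_ge0 ?addr_ge0 ?ler0n ?ltW.
rewrite -(ler_nat R); apply/ltW/(lt_trans _ (archi_boundP pos)).
by rewrite ltr_pdivlMr // mulrC -rE.
Qed.

End ShortPrefix.

Section Selecting.
Variables (R : realType) (eps : R) (wes : seq (seq nat * R)).
Variables (pts : seq (seq bool)) (k : nat) (S : seq (seq bool)).
Hypothesis eps_gt0 : 0 < eps.
Hypothesis w_ge0 : {in weights wes, forall c, 0 <= c}.
Hypothesis pts_size : {in pts, forall x, size x = size (weights wes)}.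
Hypothesis S_sel : selection pts k S.

Let st := short_prefix eps S.
Let sel := select wes pts S st.1 (subsets pts st.2).

Let sel_cases : sel = local_search (weights wes) pts S \/
  st.1 < 12%:R /\ selection pts k sel.
Proof.
have [_ st_S _] := short_prefixP eps_gt0 S.
have : sel \in local_search (weights wes) pts S ::
    (if 12%:R <= st.1 then [::] else subsets pts st.2) by apply: best_mem.
rewrite in_cons => /orP[/eqP|]; first by left.
case: leP => // lt12 /subsetsP sel_sub; right; split=> //.
by rewrite st_S // in sel_sub; case: S_sel => _ _ <-.
Qed.

Lemma selection_select : selection pts k sel.
Proof.
by case: sel_cases => [->|[]//]; apply: selection_local_search.
Qed.

Lemma select_approx O : selection pts k O ->
  (forall X, selection pts k X ->
     dispersion (weights wes) X <= dispersion (weights wes) O) ->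
  (1 - eps) * dispersion (weights wes) O <= dispersion (weights wes) sel.
Proof.
move=> O_sel O_opt; have [rE st_S _] := short_prefixP eps_gt0 S.
set V := dispersion _.
have V_O : 0 <= V O by exact: (dispersion_ge0 pts_size w_ge0 O_sel).
(* Below 12 the prefix is all of [S], so that every selection of [k] points is tried and the result
   is optimal. *)
have [h12|h12] := leP 12%:R st.1; last first.
  apply: (@le_trans _ _ (V O)).
    by rewrite mulrBl mul1r lerBlDr lerDl mulr_ge0 // ltW.
  apply: best_ge; rewrite leNgt h12 /= in_cons; apply/orP; right.
  by apply/subsetsP; rewrite st_S //; case: S_sel => _ _ ->.
have ge_local : V (local_search (weights wes) pts S) <= V sel.
  by apply: best_ge; rewrite mem_head.
apply: le_trans ge_local.
have st_k : ((size st.2)%:R : R) <= k%:R.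
  rewrite ler_nat; case: S_sel => _ _ <-; rewrite /st /short_prefix.
  elim/last_ind: (S) => // X x IH; rewrite -cats1 foldl_cat /= size_cat addn1.
  by case: ifP => _; [apply: leqW | rewrite /= ltnS].
(* [local_search_gap] needs two points; with fewer, the dispersion is 0. *)
have [k_ge2|k_lt2] := leqP 2 k; last first.
  suff -> : V O = 0.
    rewrite mulr0; apply: (dispersion_ge0 pts_size w_ge0 (k := k)).
    exact: selection_local_search.
  rewrite /V (selection_dispersion pts_size O_sel).
  case: O_sel => _ _; case: O {O_opt V_O} => [|x [|y O]] /=.
  - by rewrite /cross big_nil.
  - by rewrite /cross !big_seq1 hamming_refl.
  - by lia.
have gap := local_search_gap pts_size w_ge0 O_sel O_opt S_sel k_ge2.
rewrite -/(V _) -/(V _) in gap.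
have k_gt0 : 0 < k%:R :> R by rewrite ltr0n; lia.
(* 12 is at most eps times the length of the prefix, which is at most eps * k. *)
have : 12%:R * V O <= eps * k%:R * V O.
  rewrite ler_wpM2r // (le_trans h12) // rE ler_wpM2l // ltW //.
move=> h; have : k%:R * (V O - V (local_search (weights wes) pts S)) <=
    k%:R * (eps * V O).
  by apply: le_trans gap _; apply: le_trans h _; rewrite mulrCA mulrA.
by rewrite ler_pM2l //; lra.
Qed.

End Selecting.

(** * Translation between instances and the lists of the algorithm *)

Section Link.
Variables (R : realType) (I : dmc_instance R).
Local Notation n := (dmc_order I).
Local Notation G := (dmc_graph I).
Local Notation k := (dmc_k I).
Local Notation E := (enum (edges G)).

Implicit Types C D : {set {set 'I_n}}.

Definition vertex_list : seq nat := [seq val v | v <- enum [set: 'I_n]].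
Definition edge_list : seq (seq nat * R) :=
  [seq ([seq val v | v <- enum e], dmc_weight (d := I) e) | e : {set 'I_n} <- E].
Local Notation es := (ends edge_list).
Local Notation pts := (min_cuts vertex_list es).

Lemma enc_instance eps :
  enc (eps, (vertex_list, (edge_list, k))) =
  DCons (DNum eps) (dmc_encode_instance I) :> data R.
Proof.
congr (DCons _ (DCons _ (DCons _ _))).
  by rewrite /enc /= /enc_seq /encode_set -map_comp.
rewrite /enc /= /enc_seq /encode_set -map_comp; congr encode_seq.
apply: eq_map => e; congr (DCons _ _).
by rewrite /enc /= /enc_seq /encode_edge /encode_set -map_comp.
Qed.

Definition edge_pair (e : {set 'I_n}) : nat * nat :=
  edge_ends [seq val v | v <- enum e].

Lemma ends_edge_list : es = [seq edge_pair e | e : {set 'I_n} <- E].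
Proof. by rewrite /ends -map_comp. Qed.

Lemma edge_pairP e : e \in edges G -> exists u v : 'I_n,
  [/\ u != v, e = [set u; v] & edge_pair e = (val u, val v)].
Proof.
move=> /edges_card2; rewrite cardE /edge_pair /edge_ends => size_e.
have := enum_uniq e; have := mem_enum e.
case: (enum e) size_e => [|u [|v []]] //= _ e_uv; rewrite inE andbT => uv.
exists u, v; split=> //; apply/setP => x; rewrite !inE.
by have := e_uv x; rewrite !inE.
Qed.

Lemma edge_pair_inj : {in edges G &, injective edge_pair}.
Proof.
move=> e f /edge_pairP[u [v [_ -> ->]]] /edge_pairP[u' [v' [_ -> ->]]] [].
by move=> /val_inj-> /val_inj->.
Qed.

Lemma mem_vertex_list (v : 'I_n) : val v \in vertex_list.
Proof. by apply: map_f; rewrite mem_enum inE. Qed.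

Lemma es_inside : {in es, forall e, inside vertex_list e}.
Proof.
rewrite ends_edge_list => p /mapP[e]; rewrite mem_enum => eG ->.
have [u [v [_ _ ->]]] := edge_pairP eG.
by rewrite /inside !mem_vertex_list.
Qed.

Lemma es_uniq : uniq es.
Proof.
rewrite ends_edge_list map_inj_in_uniq ?enum_uniq // => e f.
by rewrite !mem_enum; apply: edge_pair_inj.
Qed.

Definition cut_set (B : nat -> bool) : {set {set 'I_n}} :=
  edges_between G [set v | B (val v)] (~: [set v | B (val v)]).

Lemma mem_cut_set B e : e \in edges G ->
  (e \in cut_set B) = (B (edge_pair e).1 != B (edge_pair e).2).
Proof.
move=> eG; have [u [v [uv def_e pe]]] := edge_pairP eG.
rewrite inE eG pe /=; apply/existsP/idP.
  case=> a /andP[]; rewrite inE => Ba /existsP[b /andP[]]; rewrite !inE => Bb.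
  move/eqP => e_ab.
  have : u \in e by rewrite def_e !inE eqxx.
  have : v \in e by rewrite def_e !inE eqxx orbT.
  rewrite e_ab !inE => /orP[]/eqP va /orP[]/eqP ua; move: uv;
    rewrite ua va ?eqxx // => _; by rewrite Ba (negbTE Bb).
have [Bu|Bu] := boolP (B u); have [Bv|Bv] := boolP (B v) => // _.
  exists u; rewrite inE Bu; apply/existsP; exists v; rewrite !inE Bv /=.
  by rewrite def_e.
exists v; rewrite inE Bv; apply/existsP; exists u; rewrite !inE Bu /=.
by rewrite def_e setUC.
Qed.

Lemma cut_set_sub B : cut_set B \subset edges G.
Proof. by apply/subsetP => e; rewrite inE => /andP[]. Qed.

Lemma is_cutP C : is_cut G C <-> exists2 B, nontrivial vertex_list B & C =
  cut_set B.
Proof.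
split=> [[A [A' [A0 A'0 AA' disj ->]]]|[B /andP[/hasP[x xv Bx] /hasP[y yv nBy]] ->]].
  have def_A' : A' = ~: A.
    apply/setP => v; rewrite inE; apply/idP/idP => [vA'|vA].
      by apply/negP => vA; have := disjointFr disj vA; rewrite vA'.
    by have := in_setT v; rewrite -AA' inE (negbTE vA).
  pose B i := [exists v in A, val v == i].
  have BE (v : 'I_n) : B (val v) = (v \in A).
    apply/existsP/idP => [[u /andP[uA /eqP/val_inj <-]] //|vA].
    by exists v; rewrite vA eqxx.
  exists B; last by rewrite /cut_set def_A'; congr (edges_between _ _ (~: _));
    apply/setP => v; rewrite inE BE.
  have [[a aA] [b bA]] := (set0Pn _ A0, set0Pn _ A'0).
  apply/andP; split; apply/hasP.
    by exists (val a); rewrite ?mem_vertex_list ?BE.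
  by exists (val b); rewrite ?mem_vertex_list //= BE; move: bA; rewrite def_A' inE.
exists [set v | B (val v)], (~: [set v | B (val v)]); split.
- by move: xv => /mapP[v _ xE]; apply/set0Pn; exists v; rewrite inE -xE.
- by move: yv => /mapP[v _ yE]; apply/set0Pn; exists v; rewrite !inE -yE.
- exact: setUCr.
- by rewrite -setI_eq0 setICr.
- by [].
Qed.

Definition mask_of (C : {set {set 'I_n}}) : seq bool :=
  [seq e \in C | e : {set 'I_n} <- E].

Definition set_of (x : seq bool) : {set {set 'I_n}} :=
  [set e in edges G | nth false x (index e E)].

Lemma mask_cut_set B : mask_of (cut_set B) = cut_of es B.
Proof.
rewrite ends_edge_list /cut_of -map_comp; apply/eq_in_map => e.
by rewrite mem_enum => eG; rewrite /= mem_cut_set.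
Qed.

Lemma set_ofK C : C \subset edges G -> set_of (mask_of C) = C.
Proof.
move=> /subsetP CG; apply/setP => e; rewrite inE.
have [eG|/negbTE eG] /= := boolP (e \in edges G); last first.
  by apply/esym/negP => /CG; rewrite eG.
by rewrite (nth_map e) ?index_mem ?nth_index ?mem_enum.
Qed.

Lemma card_mask C : C \subset edges G -> #|C| = count id (mask_of C).
Proof.
move=> CG; rewrite /mask_of count_map cardE (enum_subset CG) size_filter.
by apply: eq_count.
Qed.

(** A mask sees only the edges of the graph, so the inclusion has to be stated separately. *)
Lemma is_min_cutP C : is_min_cut G C <->
  C \subset edges G /\ mask_of C \in pts.
Proof.
split=> [[/is_cutP[B B_nt ->] C_min]|[CG /(min_cutsP _ es_inside es_uniq)[B [B_nt B_min] CB]]].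
  split; first exact: cut_set_sub.
  rewrite mask_cut_set; apply/(min_cutsP _ es_inside es_uniq); exists B => //.
  split=> // B' B'_nt; have := C_min (cut_set B') ltac:(by apply/is_cutP;
    exists B').
  by rewrite !card_mask ?cut_set_sub // !mask_cut_set !count_cut_of.
have def_C : C = cut_set B
  by rewrite -(set_ofK CG) CB -mask_cut_set set_ofK ?cut_set_sub.
split; first by apply/is_cutP; exists B.
move=> D /is_cutP[B' B'_nt ->].
by rewrite def_C !card_mask ?cut_set_sub // !mask_cut_set !count_cut_of B_min.
Qed.

Lemma pts_mask x : x \in pts -> exists2 C, is_min_cut G C & mask_of C = x.
Proof.
move=> xp; have /(min_cutsP _ es_inside es_uniq)[B _ def_x] := xp.
exists (cut_set B); last by rewrite mask_cut_set.
by apply/is_min_cutP; rewrite cut_set_sub mask_cut_set -def_x.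
Qed.

Lemma pts_uniq : uniq pts.
Proof. exact: dedup_uniq. Qed.

Lemma size_weights : size (weights edge_list) = size E.
Proof. by rewrite !size_map. Qed.

Lemma pts_size : {in pts, forall x, size x = size (weights edge_list)}.
Proof. by move=> x /pts_mask[C _ <-]; rewrite size_weights size_map. Qed.

Lemma weights_ge0 : {in weights edge_list, forall c, 0 <= c}.
Proof.
move=> c; rewrite /weights -map_comp => /mapP[e]; rewrite mem_enum => eG ->.
exact: dmc_weight_ge0.
Qed.

Lemma hamming_mask C C' : C \subset edges G -> C' \subset edges G ->
  hamming (weights edge_list) (mask_of C) (mask_of C') =
  \sum_(e in symdiff C C') dmc_weight (d := I) e.
Proof.
move=> CG C'G; rewrite /hamming size_weights.
transitivity (\sum_(e <- E) dmc_weight (d := I) e * ((e \in C) != (e \in C'))%:R).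
  rewrite (big_nth set0) big_mkord; apply: eq_bigr => i _.
  by rewrite /weights -map_comp !(nth_map set0).
rewrite big_enum /= big_mkcond [RHS]big_mkcond /=; apply: eq_bigr => e _.
have := subsetP CG e; have := subsetP C'G e; rewrite !inE.
case: (e \in C); case: (e \in C'); rewrite /= ?mulr0 ?mulr1 ?if_same //.
- by move=> _ /(_ isT)->.
- by move=> /(_ isT)->.
Qed.

(** Passes from the ordered pairs of [dispersion] to the pairs i < j of [d_sum]. *)
Lemma sum_sym (m : nat) (f : 'I_m -> 'I_m -> R) :
  (forall i j, f i j = f j i) -> (forall i, f i i = 0) ->
  \sum_i \sum_j f i j = 2 * \sum_(i < m) \sum_(j < m | (i < j)%N) f i j.
Proof.
move=> f_sym f_diag.
have split_i i : \sum_j f i j =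
    \sum_(j < m | (i < j)%N) f i j + \sum_(j < m | (j < i)%N) f i j.
  rewrite (bigID (fun j : 'I_m => (i < j)%N)) /=; congr (_ + _).
  rewrite (bigD1 i) /=; last by rewrite ltnn.
  rewrite f_diag add0r; apply: eq_bigl => j.
  by rewrite -leqNgt ltn_neqAle andbC.
under eq_bigr do rewrite split_i.
rewrite big_split /= mulr_natl mulr2n; congr (_ + _).
rewrite (exchange_big_dep xpredT) //=; apply: eq_bigr => i _.
by apply: eq_bigr => j _; rewrite f_sym.
Qed.

Lemma dispersion_value (C : dmc_solution I) : (forall i, C i \subset edges G) ->
  dispersion (weights edge_list) [seq mask_of (C i) | i <- enum 'I_k] =
  2 * dmc_value C.
Proof.
move=> CG; rewrite dispersion_cross; last first.
  by move=> x /mapP[i _ ->]; rewrite size_weights size_map.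
rewrite /dmc_value /d_sum.
transitivity (\sum_i \sum_j hamming (weights edge_list) (mask_of (C i))
  (mask_of (C j))).
  rewrite /cross big_map big_enum /=; apply: eq_bigr => i _.
  by rewrite big_map big_enum.
rewrite sum_sym; last 2 first.
- by move=> i j; rewrite hamming_sym.
- by move=> i; rewrite hamming_refl.
congr (_ * _); apply: eq_bigr => i _; apply: eq_bigr => j _.
exact: hamming_mask.
Qed.

Lemma mask_inj : {in [pred C : {set {set 'I_n}} | C \subset edges G] &,
  injective mask_of}.
Proof. by move=> C C'; rewrite !inE => CG C'G eq_m;
  rewrite -(set_ofK CG) eq_m set_ofK. Qed.

Lemma selection_of_feasible (C : dmc_solution I) : dmc_feasible C ->
  selection pts k [seq mask_of (C i) | i <- enum 'I_k].
Proof.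
case=> C_inj C_min; have CG i := (iffLR (is_min_cutP _) (C_min i)).1.
split; last by rewrite size_map size_enum_ord.
- rewrite map_inj_uniq ?enum_uniq // => i j /mask_inj; rewrite !inE =>
  /(_ (CG i) (CG j)).
  exact: C_inj.
- by move=> x /mapP[i _ ->]; have [] := iffLR (is_min_cutP _) (C_min i).
Qed.

Lemma feasible_of_selection S : selection pts k S ->
  exists2 C : dmc_solution I, dmc_feasible C &
    S = [seq mask_of (C i) | i <- enum 'I_k].
Proof.
case=> S_uniq S_pts S_size.
pose C : dmc_solution I := [ffun i : 'I_k => set_of (nth [::] S i)].
have S_C i : (i < k)%N -> exists2 D, is_min_cut G D & mask_of D = nth [::] S i.
  by move=> ik; apply: pts_mask; apply: S_pts; rewrite mem_nth ?S_size.
have CE (i : 'I_k) : is_min_cut G (C i) /\ mask_of (C i) = nth [::] S i.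
  have [D D_min D_i] := S_C i (ltn_ord i); rewrite ffunE -D_i set_ofK //.
  by have [] := iffLR (is_min_cutP _) D_min.
exists C.
  split=> [i j Cij|i]; last by case: (CE i).
  apply/val_inj/eqP; rewrite -(nth_uniq [::] _ _ S_uniq) ?S_size ?ltn_ord //.
  by case: (CE i) => _ <-; case: (CE j) => _ <-; rewrite Cij.
apply: (@eq_from_nth _ [::]); first by rewrite size_map size_enum_ord.
rewrite S_size => i ik; rewrite (nth_map (Ordinal ik)) ?size_enum_ord //.
by rewrite (nth_ord_enum (Ordinal ik) (Ordinal ik)); case: (CE (Ordinal ik)).
Qed.

Lemma enc_edges_of C : C \subset edges G ->
  enc (edges_of edge_list (mask_of C)) = encode_set (@encode_edge R n) C.
Proof.
move=> CG; rewrite /edges_of /mask_of /edge_list /encode_set (enum_subset CG).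
rewrite /enc /= /enc_seq -map_comp; congr encode_seq.
elim: E => //= e s IH; case: (e \in C) => /=; rewrite IH //; congr (_ :: _).
by rewrite /enc /= /enc_seq /encode_edge /encode_set -map_comp.
Qed.

Lemma enc_solution (C : dmc_solution I) : (forall i, C i \subset edges G) ->
  enc (Some [seq edges_of edge_list x | x <- [seq mask_of (C i) | i <- enum 'I_k]]) =
  DCons DNil (dmc_encode_solution C) :> data R.
Proof.
move=> CG; congr (DCons _ _); rewrite /enc /= /enc_seq -map_comp -map_comp.
by congr encode_seq; apply: eq_map => i /=; apply: enc_edges_of.
Qed.

Lemma diverse_cuts_correct eps : 0 < eps ->
  approx_answer (P := diverse_minimum_cuts R) eps I
    (enc (diverse_cuts (eps, (vertex_list, (edge_list, k))))).
Proof.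
move=> eps_gt0; rewrite /diverse_cuts /brute_force /prepare /finish /=.
rewrite first_pointsE /=; case: leqP => [k_le|k_gt]; last first.
  (* A feasible solution would be [k] distinct masks in [pts], which has fewer. *)
  right; split=> // C /selection_of_feasible[S_uniq S_pts S_size].
  have := uniq_leq_size S_uniq S_pts; rewrite S_size.
  by move: k_gt; rewrite gtn_min ltnn /= => h1 h2; have :=
    leq_ltn_trans h2 h1; rewrite ltnn.
have k_pts : (k <= size pts)%N by move: k_le; rewrite leq_min leqnn.
have S_sel : selection pts k (rev (take k pts)).
  split; first by rewrite rev_uniq take_uniq // pts_uniq.
    by move=> x; rewrite mem_rev => /mem_take.
  by rewrite size_rev size_takel.
have sel_sel := selection_select edge_list eps_gt0 S_sel.
have [C C_feas def_sel] := feasible_of_selection sel_sel.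
have CG i : C i \subset edges G by case: (iffLR (is_min_cutP _) (C_feas.2 i)).
left; exists C; split=> //.
  by rewrite [X in map _ X]def_sel enc_solution.
move=> Copt [Copt_feas Copt_opt].
have OG i : Copt i \subset edges G by case: (iffLR (is_min_cutP _) (Copt_feas.2 i)).
have O_sel := selection_of_feasible Copt_feas.
have := select_approx eps_gt0 weights_ge0 pts_size S_sel O_sel.
rewrite def_sel !dispersion_value // => approx.
rewrite -(ler_pM2l (_ : 0 < 2 :> R)) // mulrCA.
apply: approx => X /feasible_of_selection[D D_feas ->].
have DG i : D i \subset edges G by case: (iffLR (is_min_cutP _) (D_feas.2 i)).
by rewrite !dispersion_value // ler_pM2l //; apply: Copt_opt.
Qed.

End Link.

Theorem theorem5 (R : realType) : admits_PTAS (diverse_minimum_cuts R).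
Proof.
have [c c_runs] := diverse_cuts_program R; exists (c) => eps eps_gt0.
have [K K_bound] := short_prefix_bounded eps_gt0.
have [T [[d Td] _] T_runs] := c_runs K.
(* Two comes from the base [n.+2] of [poly_bound], and two from the cells that pair eps with the
   instance. *)
exists (('X + 4%N%:P) ^+ d)%R => I.
have [t [output [runs_c outE t_le]]] := T_runs
  (eps, (vertex_list I, (edge_list I, dmc_k I))) (K_bound _).
exists t, (enc (diverse_cuts (eps, (vertex_list I, (edge_list I, dmc_k I))))).
split; last exact: diverse_cuts_correct.
  by move: runs_c; rewrite outE enc_instance.
rewrite horner_exp hornerD hornerX hornerC; apply: leq_trans t_le _.
apply: leq_trans (Td _) _; rewrite natrXE; apply: leq_expn2r.
by rewrite /esize enc_instance /=; lia.
Qed.
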